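(* Let $f_\bullet\colon X_\bullet\to Y_\bullet$ be a morphism of simplicial $\Bbbk$-vector spaces. The following are equivalent: (1) $f_\bullet$ is a homotopy equivalence, i.e. $\pi_n(f_\bullet)\colon\pi_n(X_\bullet)\to\pi_n(Y_\bullet)$ is an isomorphism for all $n$; (2) $\mathrm{Res}^{\Delta}_{\Omega}(f_\bullet)$ is a quasi-isomorphism of chain complexes; (3) $\mathrm{Tor}^{\Delta}_n(f_\bullet,\Bbbk_\bullet)\colon\mathrm{Tor}^{\Delta}_n(X_\bullet,\Bbbk_\bullet)\to\mathrm{Tor}^{\Delta}_n(Y_\bullet,\Bbbk_\bullet)$ is an isomorphism for every $n\ge0$; (4) $\mathrm{Ext}^n_{\Delta}(f_\bullet,\Bbbk_\bullet^\vee)\colon\mathrm{Ext}^n_{\Delta}(Y_\bullet,\Bbbk_\bullet^\vee)\to\mathrm{Ext}^n_{\Delta}(X_\bullet,\Bbbk_\bullet^\vee)$ is an isomorphism for every $n\ge0$.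
   Context: $\Bbbk$ is a field; $V^\vee$ is the $\Bbbk$-dual. $\Delta$ denotes the simplicial category and its categorical $\Bbbk$-algebra; simplicial $\Bbbk$-vector spaces are right $\Delta$-modules, with face maps $\partial_i$. $\Omega\subseteq\Delta$ is the subalgebra generated by the identities $1_n$ and $d_{0,n}=\sum_{i=0}^n(-1)^i\partial^n_i$; $\Omega$-modules are chain complexes. $\mathrm{Res}^{\Delta}_{\Omega}$ is restriction along $\Omega\subseteq\Delta$ (the unnormalized chain complex). $\Bbbk_\bullet$ is the trivial $\Delta$-module, $\Bbbk$ in each degree with all generators acting by the identity. Combinatorial homotopy groups: for a simplicial vector space $X_\bullet$, let $Z_n=\{x\in X_n:\partial_i(x)=0\text{ for }i=0,\ldots,n\}$; declare $x\sim x'$ in $Z_n$ if there is $y\in X_{n+1}$ with $\partial_i(y)=0$ for $0\le i<n$, $\partial_n(y)=x$, $\partial_{n+1}(y)=x'$; set $\pi_n(X_\bullet)=Z_n/\!\sim$. A morphism is a homotopy equivalence if it induces isomorphisms on all $\pi_n$. *)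

(* Defs.v *)
From HB Require Import structures.
From mathcomp Require Import all_boot all_order all_algebra.
Import GRing.Theory.
Local Open Scope ring_scope.

(* A morphism [m] -> [n] of Delta (monotone map {0..m} -> {0..n}) is encoded
   by the sequence of its values a = [:: a(0); ...; a(m)].                    *)
Definition mono (m n : nat) (a : seq nat) : bool :=
  [&& size a == m.+1, sorted leq a & all (fun j => j <= n)%N a].

Definition dcomp (a b : seq nat) : seq nat := map (nth 0%N a) b.

Definition did (n : nat) : seq nat := iota 0 n.+1.

Definition coface (n i : nat) : seq nat := [seq j <- iota 0 n.+1 | j != i].

Record sset (K : fieldType) := SSet {
  sobj :> nat -> lmodType K;
  sact : forall m n : nat, seq nat -> sobj n -> sobj m;
  sact_lin : forall m n a (c : K) (u v : sobj n),
      sact m n a (c *: u + v) = c *: sact m n a u + sact m n a v;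
  sact_id : forall n (x : sobj n), sact n n (did n) x = x;
  sact_comp : forall l m n a b (x : sobj n), mono m n a -> mono l m b ->
      sact l n (dcomp a b) x = sact l m b (sact m n a x)
}.

Record smap (K : fieldType) (X Y : sset K) := SMap {
  smap_fun :> forall n, X n -> Y n;
  smap_lin : forall n (c : K) (u v : X n),
      smap_fun n (c *: u + v) = c *: smap_fun n u + smap_fun n v;
  smap_nat : forall m n a (x : X n), mono m n a ->
      smap_fun m (@sact K X m n a x) = @sact K Y m n a (smap_fun n x)
}.

Arguments sact {K} s m n _ _.
Arguments smap_fun {K X Y} s n _.
Arguments smap {K} X Y.

Set Implicit Arguments. Unset Strict Implicit. Unset Printing Implicit Defensive.

Section SSetDefs.
Variables (K : fieldType).

Definition face (X : sset K) (n i : nat) : X n.+1 -> X n :=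
  sact X n n.+1 (coface n.+1 i).
Arguments face X n i _ : clear implicits.

(* Z_n : all faces vanish (no condition for n = 0, as X_0 has no faces) *)
Definition Zcyc (X : sset K) (n : nat) : X n -> Prop :=
  match n return X n -> Prop with
  | 0 => fun _ => True
  | m.+1 => fun x => forall i, (i <= m.+1)%N -> face X m i x = 0
  end.

Definition htpc (X : sset K) (n : nat) (x x' : X n) : Prop :=
  exists y : X n.+1, (forall i, (i < n)%N -> face X n i y = 0) /\
    face X n n y = x /\ face X n n.+1 y = x'.

Definition pi_iso (X Y : sset K) (f : smap X Y) (n : nat) : Prop :=
  (forall x x' : X n, Zcyc x -> Zcyc x' -> htpc (f n x) (f n x') -> htpc x x') /\
  (forall z : Y n, Zcyc z -> exists x : X n, Zcyc x /\ htpc (f n x) z).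

Definition ucd (X : sset K) (n : nat) : X n -> X n.-1 :=
  match n return X n -> X n.-1 with
  | 0 => fun _ => 0
  | m.+1 => fun x => \sum_(i < m.+2) (-1) ^+ i *: face X m i x
  end.

(* a degreewise map of complexes (A_n, d_n : A_n -> A_{n-1}, d_0 = 0)
   induces isomorphisms on all homology groups *)
Definition homology_iso (A B : nat -> lmodType K)
    (dA : forall n, A n -> A n.-1) (dB : forall n, B n -> B n.-1)
    (g : forall n, A n -> B n) : Prop :=
  forall n,
  (forall x : A n, dA n x = 0 -> (exists y' : B n.+1, dB n.+1 y' = g n x) ->
      exists y : A n.+1, dA n.+1 y = x) /\
  (forall z : B n, dB n z = 0 ->
      exists x : A n, dA n x = 0 /\ exists y' : B n.+1, g n x = z + dB n.+1 y').

Definition quasi_iso (X Y : sset K) (f : smap X Y) : Prop :=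
  homology_iso (@ucd X) (@ucd Y) (fun n => f n).

(* A p-chain  b_p --a_p--> ... --a_2--> b_1 --a_1--> b_0  in Delta is encoded as
   (b_0, ([:: b_1; ...; b_p], [:: a_1; ...; a_p])).  The bar resolution of the
   right module M has P_p = (+)_{p-chains} M(b_0) (x) Delta(-, b_p).          *)
Definition chain := (nat * (seq nat * seq (seq nat)))%type.
Definition chd (c : chain) : nat := c.1.
Definition cobjs (c : chain) : seq nat := c.1 :: c.2.1.
Definition cmaps (c : chain) : seq (seq nat) := c.2.2.

Definition valid (p : nat) (c : chain) : bool :=
  [&& size c.2.1 == p, size c.2.2 == p &
      all (fun i => mono (nth 0 (cobjs c) i.+1) (nth 0 (cobjs c) i)
                         (nth [::] (cmaps c) i)) (iota 0 p)].

Definition cface0 (c : chain) : chain :=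
  (head 0%N c.2.1, (behead c.2.1, behead c.2.2)).

(* d_{i+1} (1 <= i+1 <= p) of a p-chain: drop b_{i+1}; compose a_{i+1} a_{i+2}
   if i+1 < p, drop a_p if i+1 = p.  The head b_0 is unchanged.             *)
Definition cface (p i : nat) (c : chain) : chain :=
  (c.1, (take i c.2.1 ++ drop i.+1 c.2.1,
         if (i.+1 < p)%N then
           take i c.2.2 ++ dcomp (nth [::] c.2.2 i) (nth [::] c.2.2 i.+1)
                          :: drop i.+2 c.2.2
         else take i c.2.2)).

(* elementary tensors  (chain c, vector in M(b_0))  of (P_p (x)_Delta k) *)
Definition term (X : sset K) := {c : chain & X (chd c)}.

Definition tmk (X : sset K) (c : chain) (v : X (chd c)) : term X :=
  Tagged (fun c => X (chd c)) v.

(* the bar differential of (P_. (x)_Delta k_.) on an elementary tensor of degree p+1 *)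
Definition dterm (X : sset K) (p : nat) (t : term X) : seq (term X) :=
  let: existT c v := t in
  tmk (c := cface0 c) (sact X (chd (cface0 c)) (chd c) (head [::] c.2.2) v)
  :: [seq tmk (c := cface p.+1 i c) ((-1) ^+ i.+1 *: v) | i <- iota 0 p.+1].

(* elements of (P_p (x)_Delta k) are finite sums of elementary tensors *)
Definition bar_d (X : sset K) (p : nat) (s : seq (term X)) : seq (term X) :=
  flatten [seq dterm p t | t <- s].

Definition coef (X : sset K) (s : seq (term X)) (c : chain) : X (chd c) :=
  \sum_(t <- s) untag 0 (fun v : X (chd c) => v) t.

Definition tvalid (X : sset K) (p : nat) (s : seq (term X)) : bool :=
  all (fun t => valid p (tag t)) s.

Definition bar_cycle (X : sset K) (p : nat) (s : seq (term X)) : Prop :=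
  tvalid p s /\
  match p with 0 => True | p'.+1 => forall c, coef (bar_d p' s) c = 0 end.

Definition bar_homologous (X : sset K) (p : nat) (s1 s2 : seq (term X)) : Prop :=
  exists s' : seq (term X), tvalid p.+1 s' /\
    forall c, coef s1 c = coef s2 c + coef (bar_d p s') c.

Definition tmap (X Y : sset K) (f : smap X Y) (s : seq (term X)) : seq (term Y) :=
  [seq tmk (c := tag t) (f (chd (tag t)) (tagged t)) | t <- s].

Definition tor_iso (X Y : sset K) (f : smap X Y) (p : nat) : Prop :=
  (forall s, bar_cycle p s -> bar_homologous p (tmap f s) [::] ->
      bar_homologous p s [::]) /\
  (forall z, bar_cycle p z ->
      exists s, bar_cycle p s /\ bar_homologous p (tmap f s) z).

(* Hom_Delta(M(b_0) (x) Delta(-, b_p), k^vee) = Hom_K(M(b_0), K), so a p-cochain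
   is a family of linear functionals indexed by the p-chains.                  *)
Definition cochain (X : sset K) := forall c : chain, X (chd c) -> K.

Definition is_cochain (X : sset K) (p : nat) (phi : cochain X) : Prop :=
  forall c, valid p c -> forall (a : K) (u v : X (chd c)),
    phi c (a *: u + v) = a * phi c u + phi c v.

Definition ceval (X : sset K) (phi : cochain X) (s : seq (term X)) : K :=
  \sum_(t <- s) phi (tag t) (tagged t).

Definition cod (X : sset K) (p : nat) (phi : cochain X) : cochain X :=
  fun (c : chain) (v : X (chd c)) => ceval phi (dterm p (@tmk X c v)).

Definition ext_cocycle (X : sset K) (p : nat) (phi : cochain X) : Prop :=
  is_cochain p phi /\
  forall c, valid p.+1 c -> forall v, @cod X p phi c v = 0.

Definition ext_cohomologous (X : sset K) (p : nat) (phi1 phi2 : cochain X) : Prop :=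
  match p with
  | 0 => forall c, valid 0 c -> forall v, phi1 c v = phi2 c v
  | p'.+1 => exists psi : cochain X, is_cochain p' psi /\
      forall c, valid p'.+1 c -> forall v, phi1 c v = phi2 c v + @cod X p' psi c v
  end.

Definition czero (X : sset K) : cochain X := fun _ _ => 0.

Definition cpull (X Y : sset K) (f : smap X Y) (phi : cochain Y) : cochain X :=
  fun c v => phi c (f (chd c) v).

Definition ext_iso (X Y : sset K) (f : smap X Y) (p : nat) : Prop :=
  (forall phi : cochain Y, ext_cocycle p phi ->
      ext_cohomologous p (cpull f phi) (@czero X) ->
      ext_cohomologous p phi (@czero Y)) /\
  (forall theta : cochain X, ext_cocycle p theta ->
      exists phi : cochain Y, ext_cocycle p phi /\
        ext_cohomologous p theta (cpull f phi)).

End SSetDefs.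

(* Main.v *)
(** Over a field, the unnormalized complex C(X) and the complex B(X) = X (x)_Delta k
    coming from the bar resolution are the two edges of a double complex
    D_(p,q) = (+) X(b_0), summed over the chains [q] -> b_p -> ... -> b_0 in Delta.
    For fixed [q] the bar complex is contracted onto X_q by repeating the identity of
    [q] at the end of a chain; for a fixed p-chain the complex of the simplex b_p is
    contracted onto k by coning at its vertex 0.  Hence homology classes of C(X) and
    B(X) correspond along staircases of D, naturally in X, so (2) and (3) agree.
    Ext is computed by the dual of B(X), and over a field a map of complexes is a
    quasi-isomorphism iff its dual is.  Finally (1) and (2) are compared through the
    Moore complex: x |-> x - s_k d_k x successively kills the faces of a cycle
    without changing its class. *)

(* The double complex is the balancing of Tor. In degree q, [C(X)] is the tensor product over Delta
   of X with the free module on [q], and these free modules resolve the trivial module. So D is the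
   tensor product of two resolutions, one of X and one of the trivial module, which is why both its
   rows and its columns are exact. The total complex is never formed: the squares of D commute
   without signs, and classes are carried across D by a relation that respects differences and sends
   boundaries to boundaries. Symmetry under transposition then gives both directions of the
   comparison. For Ext, adjunction turns maps from the bar resolution into the dual of the trivial
   module into functionals on the bar complex. The spaces may be infinite-dimensional, so passing
   between a complex and its dual needs functionals extended from arbitrary subspaces, hence Zorn's
   lemma. *)
From HB Require Import structures.
Require Import Defs.
From mathcomp Require Import all_boot all_order all_algebra.
From mathcomp Require Import zify boolp classical_sets.

Set Implicit Arguments. Unset Strict Implicit. Unset Printing Implicit Defensive.
Import GRing.Theory.
Local Open Scope ring_scope.
Local Open Scope quotient_scope.

(** * Direct sums *)

Section TaggedSums.
Variables (K : fieldType) (I : eqType) (M : I -> lmodType K).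

Definition tcoef (s : seq {i : I & M i}) (i : I) : M i :=
  \sum_(t <- s) untag 0 (fun v : M i => v) t.

Lemma untag_id i (v : M i) :
  untag 0 (fun v : M i => v) (Tagged (fun i => M i) v) = v.
Proof.
by rewrite (@untagE _ (fun i => M i) _ _ _ _ (Tagged (fun i => M i) v) (erefl i)).
Qed.

Lemma untag_neq i j (v : M i) : i != j ->
  untag 0 (fun v : M j => v) (Tagged (fun i => M i) v) = 0.
Proof. by move=> ij; rewrite untag_dflt. Qed.

Lemma untag_linear i j :
  linear (fun v : M i => untag 0 (fun v : M j => v) (Tagged (fun i => M i) v)).
Proof.
move=> c u v; case: (eqVneq i j) => [e|ij]; first by case: j / e; rewrite !untag_id.
by rewrite !untag_neq // scaler0 addr0.
Qed.

Lemma linear_fun0 (U V : lmodType K) (g : U -> V) : linear g -> g 0 = 0.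
Proof. by move=> lg; have := lg (-1) 0 0; rewrite !scaleN1r !addNr. Qed.

Lemma linear_funD (U V : lmodType K) (g : U -> V) u v :
  linear g -> g (u + v) = g u + g v.
Proof. by move=> lg; have := lg 1 u v; rewrite !scale1r. Qed.

Lemma linear_funZ (U V : lmodType K) (g : U -> V) c u :
  linear g -> g (c *: u) = c *: g u.
Proof. by move=> lg; have := lg c u 0; rewrite (linear_fun0 lg) !addr0. Qed.

Lemma linear_fun_sum (U V : lmodType K) (g : U -> V) (T : Type) (s : seq T) (F : T -> U) :
  linear g -> g (\sum_(t <- s) F t) = \sum_(t <- s) g (F t).
Proof.
move=> lg; elim: s => [|t s IHs]; first by rewrite !big_nil linear_fun0.
by rewrite !big_cons linear_funD // IHs.
Qed.

(** Group the terms by tag. Linearity is asked only on [r], because cochains are linear only on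
    valid chains. *)
Lemma sum_tcoef (V : lmodType K) (G : forall i, M i -> V) (r : seq I)
    (s : seq {i : I & M i}) :
    uniq r -> {subset map tag s <= r} -> (forall i, i \in r -> linear (G i)) ->
  \sum_(t <- s) G (tag t) (tagged t) = \sum_(i <- r) G i (tcoef s i).
Proof.
move=> ur sr lG.
transitivity (\sum_(i <- r) \sum_(t <- s) G i (untag 0 (fun v : M i => v) t)).
  rewrite exchange_big /= [LHS]big_seq [RHS]big_seq.
  apply: eq_bigr => -[i v] sv /=.
  have ir : i \in r by apply: sr; apply/mapP; exists (existT _ i v).
  rewrite (bigD1_seq i) //= untag_id big_seq_cond big1 ?addr0 // => j /andP[jr ji].
  by rewrite untag_neq 1?eq_sym // linear_fun0 //; apply: lG.
rewrite big_seq [RHS]big_seq; apply: eq_bigr => i ir.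
by rewrite linear_fun_sum //; apply: lG.
Qed.

Lemma eq_tcoef_sum (V : lmodType K) (G : forall i, M i -> V) (P : pred I)
    (s1 s2 : seq {i : I & M i}) :
    (forall i, P i -> linear (G i)) -> all P (map tag s1) -> all P (map tag s2) ->
    (forall i, tcoef s1 i = tcoef s2 i) ->
  \sum_(t <- s1) G (tag t) (tagged t) = \sum_(t <- s2) G (tag t) (tagged t).
Proof.
move=> lG P1 P2 e12; pose r := undup (map tag (s1 ++ s2)).
have Pr i : i \in r -> linear (G i).
  rewrite mem_undup map_cat mem_cat => /orP[/(allP P1)|/(allP P2)]; exact: lG.
have sub1 : {subset map tag s1 <= r} by move=> i; rewrite mem_undup map_cat mem_cat => ->.
have sub2 : {subset map tag s2 <= r}.
  by move=> i; rewrite mem_undup map_cat mem_cat orbC => ->.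
rewrite !(sum_tcoef (r := r)) ?undup_uniq //.
by apply: eq_bigr => i _; rewrite e12.
Qed.

Lemma tcoef_out s i : i \notin map tag s -> tcoef s i = 0.
Proof.
move=> si; rewrite /tcoef big_seq big1 // => t ts.
by rewrite untag_dflt //; apply: contraNneq si => <-; apply: map_f.
Qed.

Lemma tcoef_cat s1 s2 i : tcoef (s1 ++ s2) i = tcoef s1 i + tcoef s2 i.
Proof. by rewrite /tcoef big_cat. Qed.

Definition tscale (c : K) (s : seq {i : I & M i}) : seq {i : I & M i} :=
  [seq Tagged (fun i => M i) (c *: (tagged t : M (tag t))) | t : {i : I & M i} <- s].

Lemma tcoef_scale c s i : tcoef (tscale c s) i = c *: tcoef s i.
Proof.
rewrite /tcoef big_map scaler_sumr; apply: eq_bigr => -[j v] _ /=.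
exact: linear_funZ (@untag_linear j i).
Qed.

End TaggedSums.

(** * The direct sum as a quotient of lists of tagged vectors *)

Section DirectSum.
Variables (K : fieldType) (I : choiceType) (P : pred I) (M : I -> lmodType K).

Let N (j : {i | P i}) : lmodType K := M (val j).
Let T := seq {j : {i | P i} & N j}.

(** Only the tags that occur are tested, so the relation is boolean, as the quotient requires; at
    any other tag both coefficients are zero. *)
Definition dsum_eq (s1 s2 : T) : bool :=
  all (fun i => tcoef s1 i == tcoef s2 i) (map tag (s1 ++ s2)).

Lemma dsum_eqP s1 s2 : reflect (forall i, tcoef s1 i = tcoef s2 i) (dsum_eq s1 s2).
Proof.
apply: (iffP allP) => [e i|e i _]; last by rewrite e.
have [/e/eqP //|] := boolP (i \in map tag (s1 ++ s2)).
by rewrite map_cat mem_cat negb_or => /andP[i1 i2]; rewrite !tcoef_out.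
Qed.

Fact dsum_eq_refl : reflexive dsum_eq.
Proof. by move=> s; apply/dsum_eqP. Qed.
Fact dsum_eq_sym : symmetric dsum_eq.
Proof. by move=> s t; apply/dsum_eqP/dsum_eqP. Qed.
Fact dsum_eq_trans : transitive dsum_eq.
Proof.
by move=> s t u /dsum_eqP e1 /dsum_eqP e2; apply/dsum_eqP => i; rewrite e1.
Qed.
Canonical dsum_equiv := EquivRel dsum_eq dsum_eq_refl dsum_eq_sym dsum_eq_trans.

Definition dsum := {eq_quot dsum_equiv}.
HB.instance Definition _ := Choice.on dsum.

Definition dcoef (w : dsum) i : N i := tcoef (repr w) i.

Lemma dcoef_pi (s : T) i : dcoef (\pi_dsum s) i = tcoef s i.
Proof. by have /eqquotP/dsum_eqP/(_ i) : repr (\pi_dsum s) = s %[mod dsum] by rewrite reprK. Qed.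

(** Through this lemma every module axiom below reduces to the same axiom in each [N i]. *)
Lemma dcoef_inj w1 w2 : (forall i, dcoef w1 i = dcoef w2 i) -> w1 = w2.
Proof. by move=> e; rewrite -[w1]reprK -[w2]reprK; apply/eqquotP/dsum_eqP. Qed.

Definition dsum_add (w1 w2 : dsum) : dsum := \pi_dsum (repr w1 ++ repr w2).
Definition dsum_scale (c : K) (w : dsum) : dsum := \pi_dsum (tscale c (repr w)).
Definition dsum_zero : dsum := \pi_dsum [::].

Let dcoefD w1 w2 i : dcoef (dsum_add w1 w2) i = dcoef w1 i + dcoef w2 i.
Proof. by rewrite dcoef_pi tcoef_cat. Qed.
Let dcoefZ c w i : dcoef (dsum_scale c w) i = c *: dcoef w i.
Proof. by rewrite dcoef_pi tcoef_scale. Qed.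
Let dcoef0 i : dcoef dsum_zero i = 0.
Proof. by rewrite dcoef_pi /tcoef big_nil. Qed.

Fact dsum_addA : associative dsum_add.
Proof. by move=> u v w; apply: dcoef_inj => i; rewrite !dcoefD addrA. Qed.
Fact dsum_addC : commutative dsum_add.
Proof. by move=> u v; apply: dcoef_inj => i; rewrite !dcoefD addrC. Qed.
Fact dsum_add0 : left_id dsum_zero dsum_add.
Proof. by move=> u; apply: dcoef_inj => i; rewrite dcoefD dcoef0 add0r. Qed.
Fact dsum_addN : left_inverse dsum_zero (dsum_scale (-1)) dsum_add.
Proof. by move=> u; apply: dcoef_inj => i; rewrite dcoefD dcoefZ dcoef0 scaleN1r addNr. Qed.
HB.instance Definition _ :=
  GRing.isZmodule.Build dsum dsum_addA dsum_addC dsum_add0 dsum_addN.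

Fact dsum_scaleA a b v : dsum_scale a (dsum_scale b v) = dsum_scale (a * b) v.
Proof. by apply: dcoef_inj => i; rewrite !dcoefZ scalerA. Qed.
Fact dsum_scale1 : left_id 1 dsum_scale.
Proof. by move=> v; apply: dcoef_inj => i; rewrite dcoefZ scale1r. Qed.
Fact dsum_scaleDr : right_distributive dsum_scale +%R.
Proof. by move=> a u v; apply: dcoef_inj => i; rewrite !(dcoefZ, dcoefD) scalerDr. Qed.
Fact dsum_scaleDl v : {morph dsum_scale^~ v : a b / a + b}.
Proof. by move=> a b; apply: dcoef_inj => i; rewrite !(dcoefZ, dcoefD) scalerDl. Qed.
HB.instance Definition _ :=
  GRing.Zmodule_isLmodule.Build K dsum dsum_scaleA dsum_scale1 dsum_scaleDr dsum_scaleDl.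

(* The generator is zero when the index does not satisfy [P]. *)
Definition gen (i : I) (v : M i) : dsum :=
  match boolP (P i) with
  | AltTrue h => \pi_dsum [:: Tagged (fun j => N j) (v : N (exist _ i h))]
  | AltFalse _ => 0
  end.

Lemma gen_linear i : linear (@gen i).
Proof.
move=> c u v; rewrite /gen; case: {-}_ / boolP => h; last by rewrite scaler0 addr0.
apply: dcoef_inj => j; rewrite [RHS]dcoefD dcoefZ !dcoef_pi /tcoef !big_seq1.
exact: untag_linear.
Qed.
HB.instance Definition _ i := GRing.isLinear.Build K (M i) dsum _ (@gen i) (@gen_linear i).

Lemma dsum_gen (w : dsum) :
  exists2 s : seq {i : I & M i}, all P (map tag s) &
    w = \sum_(t <- s) gen (tagged t).
Proof.
exists [seq Tagged (fun i => M i) (tagged t : M (val (tag t))) | t <- repr w].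
  by rewrite -map_comp; apply/allP => _ /mapP[[[i Pi] v] _ ->].
rewrite big_map -{1}[w]reprK; elim: (repr w) => [|[[i Pi] v] s IHs].
  by rewrite big_nil.
rewrite big_cons /= -IHs; apply: dcoef_inj => j; rewrite [RHS]dcoefD !dcoef_pi.
rewrite /tcoef big_cons /=; congr (_ + _).
rewrite /gen; case: {-}_ / boolP => [h|]; last by rewrite Pi.
by rewrite dcoef_pi /tcoef big_seq1 (bool_irrelevance h Pi).
Qed.

Lemma dsum_ind (Q : dsum -> Prop) :
    Q 0 -> (forall i (v : M i) w, P i -> Q w -> Q (gen v + w)) -> forall w, Q w.
Proof.
move=> Q0 QD w; have [s Ps ->] := dsum_gen w.
elim: s Ps => [|[i v] s IHs] /=; first by rewrite big_nil.
by case/andP=> Pi /IHs Qs; rewrite big_cons; apply: QD.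
Qed.

Lemma dsum_ext (V : lmodType K) (g h : dsum -> V) :
    linear g -> linear h -> (forall i (v : M i), P i -> g (gen v) = h (gen v)) ->
  forall w, g w = h w.
Proof.
move=> lg lh e; elim/dsum_ind => [|i v w Pi IHw]; first by rewrite !linear_fun0.
by rewrite !linear_funD // IHw e.
Qed.

(** The universal map out of the direct sum, computed on a chosen representative; [eq_tcoef_sum]
    removes the dependence on the choice. *)
Definition dlift (V : lmodType K) (G : forall i, M i -> V) (w : dsum) : V :=
  \sum_(t <- repr w) @G (val (tag t)) (tagged t).

Section Lift.
Variables (V : lmodType K) (G : forall i, M i -> V).
Hypothesis lG : forall i, P i -> linear (@G i).

Let dlift_pi (s : T) :
  dlift G (\pi_dsum s) = \sum_(t <- s) @G (val (tag t)) (tagged t).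
Proof.
apply: (@eq_tcoef_sum _ _ N V (fun i v => G v) predT); rewrite ?all_predT //.
  by move=> [i Pi] _; apply: lG.
exact: dcoef_pi.
Qed.

Lemma dlift_linear : linear (dlift G).
Proof.
move=> c u v.
have -> : c *: u + v = \pi_dsum (tscale c (repr u) ++ repr v).
  by apply: dcoef_inj => i; rewrite dcoefD dcoefZ dcoef_pi tcoef_cat tcoef_scale.
rewrite dlift_pi big_cat; congr (_ + _); rewrite big_map /dlift scaler_sumr.
apply: eq_bigr => -[[i Pi] x] _ /=.
exact: linear_funZ (lG Pi).
Qed.

Lemma dlift_gen i (v : M i) : P i -> dlift G (gen v) = G v.
Proof.
move=> Pi; rewrite /gen; case: {-}_ / boolP => [h|]; last by rewrite Pi.
by rewrite dlift_pi big_seq1.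
Qed.
End Lift.

(** The dictionary between equality in the direct sum and the coefficientwise equality used to
    define bar cycles. From left to right, lift the [j]-th projection and apply it to both sides. *)
Lemma sum_gen_eqP (s1 s2 : seq {i : I & M i}) :
    all P (map tag s1) -> all P (map tag s2) ->
  (\sum_(t <- s1) gen (tagged t) = \sum_(t <- s2) gen (tagged t)) <->
  (forall i, tcoef s1 i = tcoef s2 i).
Proof.
move=> P1 P2; split=> [e j|]; last first.
  exact: (@eq_tcoef_sum _ _ M _ (fun i v => gen v) P) (fun i _ => @gen_linear i) P1 P2.
pose G i (v : M i) := untag 0 (fun v : M j => v) (Tagged (fun i => M i) v).
have lG i : P i -> linear (@G i) by move=> _; apply: untag_linear.
have eG s : all P (map tag s) -> dlift G (\sum_(t <- s) gen (tagged t)) = tcoef s j.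
  move=> Ps; rewrite (linear_fun_sum _ _ (dlift_linear lG)) /tcoef.
  rewrite big_seq [RHS]big_seq; apply: eq_bigr => -[i v] ts.
  by rewrite dlift_gen //=; apply: (allP Ps); apply: (map_f tag ts).
by rewrite -!eG // e.
Qed.

End DirectSum.

(** * Double complexes with resolving rows and columns *)

Definition ndiff (K : fieldType) (A : nat -> lmodType K)
    (d : forall n, A n.+1 -> A n) (n : nat) : A n -> A n.-1 :=
  match n return A n -> A n.-1 with 0 => fun _ => 0 | m.+1 => d m end.

(* Double complexes whose rows are resolutions of [bC] and whose columns are
   resolutions of [bB]. *)
Record bicomplex (K : fieldType) := Bicomplex {
  bD : nat -> nat -> lmodType K;
  bC : nat -> lmodType K;
  bB : nat -> lmodType K;
  dh : forall p q, {linear bD p.+1 q -> bD p q};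
  dv : forall p q, {linear bD p q.+1 -> bD p q};
  dC : forall q, {linear bC q.+1 -> bC q};
  dB : forall p, {linear bB p.+1 -> bB p};
  eC : forall q, {linear bD 0 q -> bC q};
  eB : forall p, {linear bD p 0 -> bB p};
  dhv : forall p q u, dh p q (dv p.+1 q u) = dv p q (dh p q.+1 u);
  eC_dv : forall q u, eC q (dv 0 q u) = dC q (eC q.+1 u);
  eB_dh : forall p u, eB p (dh p 0 u) = dB p (eB p.+1 u);
  dh_dh : forall p q u, dh p q (dh p.+1 q u) = 0;
  dv_dv : forall p q u, dv p q (dv p q.+1 u) = 0;
  eC_dh : forall q u, eC q (dh 0 q u) = 0;
  eB_dv : forall p u, eB p (dv p 0 u) = 0;
  eC_onto : forall q x, exists u, eC q u = x;
  eB_onto : forall p x, exists u, eB p u = x;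
  row0_exact : forall q u, eC q u = 0 -> exists w, dh 0 q w = u;
  col0_exact : forall p u, eB p u = 0 -> exists w, dv p 0 w = u;
  row_exact : forall p q u, dh p q u = 0 -> exists w, dh p.+1 q w = u;
  col_exact : forall p q u, dv p q u = 0 -> exists w, dv p q.+1 w = u
}.

(** Because the squares commute without signs, the axioms are symmetric, and each lemma on
    staircases also holds with the two edges exchanged. *)
Definition transpose (K : fieldType) (E : bicomplex K) : bicomplex K :=
  @Bicomplex K (fun p q => bD E q p) (bB E) (bC E)
    (fun p q => dv E q p) (fun p q => dh E q p) (dB E) (dC E) (eB E) (eC E)
    (fun p q u => esym (dhv u)) (@eB_dh K E) (@eC_dv K E)
    (fun p q u => dv_dv u) (fun p q u => dh_dh u) (@eB_dv K E) (@eC_dh K E)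
    (@eB_onto K E) (@eC_onto K E) (@col0_exact K E) (@row0_exact K E)
    (fun p q u => @col_exact K E q p u) (fun p q u => @row_exact K E q p u).

(** * Staircases in a double complex *)

Section Down.
Variables (K : fieldType) (E : bicomplex K).

(* A staircase [u = u_0, u_1, ..., u_q] with [dv u_i = dh u_(i+1)] leads from [u]
   to the bottom row, where [u_q] projects to [s]. *)
Fixpoint down q : forall p n, bD E p q -> bB E n -> Prop :=
  match q with
  | 0 => fun p n u s => exists e : p = n, ecast m (bB E m) e (eB E p u) = s
  | q'.+1 => fun p n u s => exists2 u' : bD E p.+1 q', dv E p q' u = dh E p q' u' &
      down u' s
  end.

End Down.

Section Staircase.
Variables (K : fieldType).
Implicit Types E : bicomplex K.

(** A relation and not a map, since each step of a staircase chooses a preimage; [linkedB] and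
    [linked_boundary] together show that the choices do not affect the homology class. *)
Definition linked E n (x : bC E n) (s : bB E n) : Prop :=
  exists2 u : bD E 0 n, eC E n u = x & down u s.

(** Reversal with an accumulator: the part already passed is kept as a staircase of the transpose,
    and the next relation [dv u = dh u'], read backwards, lengthens it by one step. *)
Lemma down_slide E q p n (x : bC E n) (s : bB E n) (u : bD E p q) :
    (p + q)%N = n -> down u s -> @down K (transpose E) p q n u x ->
  @linked (transpose E) n s x.
Proof.
elim: q p u => [|q IHq] p u; last first.
  rewrite -addSnnS => /IHq{}IHq [u' du u's] ux.
  by apply: (IHq u') => //; exists u.
rewrite addn0 => e; case: n / e x s => x s [e' <-] xu.
by rewrite eq_axiomK /=; exists u.
Qed.

Lemma linked_sym E n (x : bC E n) (s : bB E n) :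
  linked x s -> @linked (transpose E) n s x.
Proof.
by case=> u ux us; apply: (down_slide _ us) => //; exists erefl.
Qed.

(** Only the first step has to be supplied. Once [dv u = dh u'], one has
    [dh (dv u') = dv (dh u') = dv (dv u) = 0], and exactness of the row yields the next step. *)
Lemma down_exists E q p n (u : bD E p q) : (p + q)%N = n ->
  match q return bD E p q -> Prop with
  | 0 => fun _ => True
  | q'.+1 => fun u => exists u', dv E p q' u = dh E p q' u'
  end u -> exists s : bB E n, down u s.
Proof.
elim: q p u => [|q IHq] p u.
  by rewrite addn0 => e _; case: n / e; exists (eB E p u), erefl.
move=> e [u' du]; have [||s u's] := IHq p.+1 u'; first by rewrite addSnnS.
  case: q {IHq e} u u' du => [//|q] u u' du.
  have [|w dw] := @row_exact K E p q (dv E p.+1 q u').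
    by rewrite dhv -du dv_dv.
  by exists w.
by exists s, u'.
Qed.

Lemma linked_exists E n (x : bC E n) :
  ndiff (dC E) x = 0 -> exists s, linked x s.
Proof.
move=> dx; have [u ux] := eC_onto x.
have [//||s us] := @down_exists E n 0 n u; last by exists s, u.
case: n x dx u ux => //= n x dx u ux.
by have [|w <-] := @row0_exact K E n (dv E 0 n u); [rewrite eC_dv ux|exists w].
Qed.

Lemma down_cycle E q p n (u : bD E p q.+1) (s : bB E n) :
  down u s -> ndiff (dB E) s = 0.
Proof.
elim: q p u => [|q IHq] p u [u' du]; last exact: IHq.
by case=> e <-; case: n / e s => s /=; rewrite -eB_dh -du eB_dv.
Qed.

Lemma linked_cycle E n (x : bC E n) (s : bB E n) :
  linked x s -> ndiff (dB E) s = 0.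
Proof. by case=> u _; case: n x s u => [//|n] x s u; apply: down_cycle. Qed.

Lemma downB E q p n (u v : bD E p q) (s t : bB E n) :
  down u s -> down v t -> down (u - v) (s - t).
Proof.
elim: q p u v => [|q IHq] p u v.
  case=> e <- [e' <-]; case: n / e s t e' => s t e'; rewrite eq_axiomK.
  by exists erefl; rewrite /= linearB.
by case=> u' du us [v' dv' vt]; exists (u' - v'); [rewrite !linearB du dv' | apply: IHq].
Qed.

Lemma linkedB E n (x y : bC E n) (s t : bB E n) :
  linked x s -> linked y t -> linked (x - y) (s - t).
Proof.
by case=> u <- us [v <- vt]; exists (u - v); [rewrite linearB|apply: downB].
Qed.

(** The shape [dv v + dh w] propagates: [u' - dv w] is killed by [dh], so [u' = dv w + dh z] for
    some [z]. In the bottom row [eB] kills the first summand and makes the second a boundary. *)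
Lemma down_boundary E q p n (u : bD E p q) (s : bB E n) (v : bD E p q.+1)
    (w : bD E p.+1 q) :
  down u s -> u = dv E p q v + dh E p q w -> exists t, s = dB E n t.
Proof.
elim: q p u v w => [|q IHq] p u v w.
  case=> e <- ->; case: n / e s => s /=.
  by rewrite linearD eB_dv add0r eB_dh; exists (eB E p.+1 w).
case=> u' du us eu.
have [z dz] : exists z, dh E p.+1 q z = u' - dv E p.+1 q w.
  by apply: row_exact; rewrite linearB -du eu linearD dv_dv add0r dhv subrr.
by apply: (IHq _ _ w z us); rewrite dz addrC subrK.
Qed.

Lemma linked_boundary E n (y : bC E n.+1) (s : bB E n) :
  linked (dC E n y) s -> exists t, s = dB E n t.
Proof.
case=> u ux us; have [v vy] := eC_onto y.
have [w dw] : exists w, dh E 0 n w = u - dv E 0 n v.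
  by apply: row0_exact; rewrite linearB eC_dv ux vy subrr.
by apply: (down_boundary us (v := v) (w := w)); rewrite dw addrC subrK.
Qed.

End Staircase.

(** * Comparison of the two edges along a morphism of double complexes *)

Record bimorphism (K : fieldType) (E F : bicomplex K) := Bimorphism {
  mD : forall p q, {linear bD E p q -> bD F p q};
  mC : forall n, {linear bC E n -> bC F n};
  mB : forall n, {linear bB E n -> bB F n};
  m_dh : forall p q u, mD p q (dh E p q u) = dh F p q (mD p.+1 q u);
  m_dv : forall p q u, mD p q (dv E p q u) = dv F p q (mD p q.+1 u);
  m_dC : forall n u, mC n (dC E n u) = dC F n (mC n.+1 u);
  m_dB : forall n u, mB n (dB E n u) = dB F n (mB n.+1 u);
  m_eC : forall q u, mC q (eC E q u) = eC F q (mD 0 q u);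
  m_eB : forall p u, mB p (eB E p u) = eB F p (mD p 0 u)
}.

Definition mtranspose (K : fieldType) (E F : bicomplex K) (g : bimorphism E F) :
    bimorphism (transpose E) (transpose F) :=
  @Bimorphism K (transpose E) (transpose F) (fun p q => mD g q p) (mB g) (mC g)
   (fun p q => @m_dv _ _ _ g q p) (fun p q => @m_dh _ _ _ g q p)
   (@m_dB _ _ _ g) (@m_dC _ _ _ g) (@m_eB _ _ _ g) (@m_eC _ _ _ g).

Section Comparison.
Variables (K : fieldType).
Implicit Types E F : bicomplex K.

Lemma down_map E F (g : bimorphism E F) q p n (u : bD E p q) (s : bB E n) :
  down u s -> down (mD g p q u) (mB g n s).
Proof.
elim: q p u => [|q IHq] p u.
  by case=> e <-; case: n / e s => s; exists erefl; rewrite /= m_eB.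
by case=> u' du us; exists (mD g p.+1 q u'); rewrite -?m_dv ?du ?m_dh //; apply: IHq.
Qed.

Lemma linked_map E F (g : bimorphism E F) n (x : bC E n) (s : bB E n) :
  linked x s -> linked (mC g n x) (mB g n s).
Proof. by case=> u <- us; exists (mD g 0 n u); [rewrite m_eC|apply: down_map]. Qed.

Lemma homology_iso_row_col E F (g : bimorphism E F) :
  homology_iso (ndiff (dC E)) (ndiff (dC F)) (mC g) ->
  homology_iso (ndiff (dB E)) (ndiff (dB F)) (mB g).
Proof.
move=> gC n; have [injC surjC] := gC n; split=> [s ds [t dt]|z dz].
  have [x /= sx] := linked_exists (E := transpose E) ds.
  have dx := linked_cycle sx; have xs : linked x s := linked_sym sx.
  have [y' ey'] : exists y', mC g n x = dC F n y'.
    apply: (linked_boundary (E := transpose F) (y := t)).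
    rewrite /= in dt *; rewrite dt; exact: (linked_map (mtranspose g) sx).
  have [|y dy] := injC x dx; first by exists y'.
  by rewrite -dy in xs; have [w ->] := linked_boundary xs; exists w.
have [x' /= zx'] := linked_exists (E := transpose F) dz.
have dx' := linked_cycle zx'; have x'z : linked x' z := linked_sym zx'.
have [x [dx [y' ey']]] := surjC x' dx'.
have [s xs] := linked_exists dx.
exists s; split; first exact: linked_cycle xs.
(* [mC g n x] and [x'] differ by a boundary, and the difference of their links ends at
   [mB g n s - z], which is therefore a boundary too. *)
have := linkedB (linked_map g xs) x'z.
rewrite ey' addrC addKr => /linked_boundary[t et].
by exists t; rewrite /= -et addrC subrK.
Qed.

Lemma homology_iso_row_colE E F (g : bimorphism E F) :
  homology_iso (ndiff (dC E)) (ndiff (dC F)) (mC g) <->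
  homology_iso (ndiff (dB E)) (ndiff (dB F)) (mB g).
Proof.
split; first exact: homology_iso_row_col.
exact: (homology_iso_row_col (g := mtranspose g)).
Qed.

End Comparison.

(** * Simplicial identities *)

Section Delta.

Lemma sorted_mkseq (g : nat -> nat) n :
  (forall i j, (i <= j)%N -> (g i <= g j)%N) -> sorted leq (mkseq g n).
Proof.
move=> mg; apply/(sortedP 0%N) => i; rewrite size_mkseq => ni.
by rewrite !nth_mkseq //; [apply: mg|apply: ltnW].
Qed.

Lemma mono_mkseq (g : nat -> nat) m n :
    (forall i j, (i <= j)%N -> (g i <= g j)%N) -> (g m <= n)%N ->
  mono m n (mkseq g m.+1).
Proof.
move=> mg gm; apply/and3P; split; [by rewrite size_mkseq|exact: sorted_mkseq|].
apply/allP => x /mapP[i]; rewrite mem_iota add0n ltnS => im ->.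
exact: leq_trans (mg _ _ im) gm.
Qed.

Lemma monoP m n a : reflect
  [/\ size a = m.+1, forall i j, (i <= j)%N -> (j <= m)%N -> (nth 0%N a i <= nth 0%N a j)%N
    & forall i, (i <= m)%N -> (nth 0%N a i <= n)%N] (mono m n a).
Proof.
apply: (iffP and3P) => [[/eqP sa sort_a /allP le_a]|[sa mono_a le_a]].
  split=> // [i j ij jm|i im]; last by apply: le_a; rewrite mem_nth ?sa.
  by apply: (sorted_leq_nth leq_trans leqnn); rewrite ?inE ?sa ?ltnS //; apply: leq_trans jm.
split; [by rewrite sa|apply/(sortedP 0%N) => i; rewrite sa => im; apply: mono_a => //|].
by apply/(all_nthP 0%N) => i; rewrite sa; apply: le_a.
Qed.

Lemma mono_nth m n a : mono m n a -> mkseq (nth 0%N a) m.+1 = a.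
Proof. by case/monoP=> sa _ _; rewrite -sa mkseq_nth. Qed.

Lemma mono_dcomp l m n a b : mono m n a -> mono l m b -> mono l n (dcomp a b).
Proof.
move=> /monoP[sa mono_a le_a] /monoP[sb mono_b le_b]; apply/monoP.
split=> [|i j ij jl|i il]; first by rewrite size_map.
  rewrite !(nth_map 0%N) ?sb ?ltnS //; last exact: leq_trans jl.
  by apply: mono_a; [apply: mono_b|apply: le_b].
by rewrite (nth_map 0%N) ?sb //; apply/le_a/le_b.
Qed.

Lemma dcompA l m n a b c : mono m n b -> mono l m c ->
  dcomp (dcomp a b) c = dcomp a (dcomp b c).
Proof.
move=> /monoP[sb _ _] /and3P[_ _ /allP c_le]; rewrite /dcomp -map_comp.
by apply/eq_in_map => i /c_le ic /=; rewrite (nth_map 0%N) ?sb.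
Qed.

Lemma dcomp_mkseq (g h : nat -> nat) m l :
    (forall i, (i <= l)%N -> (h i <= m)%N) ->
  dcomp (mkseq g m.+1) (mkseq h l.+1) = mkseq (g \o h) l.+1.
Proof.
move=> hm; rewrite /dcomp [in LHS]/(mkseq h _) -map_comp; apply/eq_in_map => i.
by rewrite mem_iota add0n ltnS /= => /hm im; rewrite nth_mkseq.
Qed.

Lemma did_mkseq n : did n = mkseq id n.+1.
Proof. by rewrite /mkseq map_id. Qed.

Lemma mono_did n : mono n n (did n).
Proof. by rewrite did_mkseq; apply: mono_mkseq. Qed.

Lemma dcomp_did m n a : mono m n a -> dcomp a (did m) = a.
Proof. by move=> /mono_nth; rewrite /dcomp /did. Qed.

Lemma did_dcomp m n a : mono m n a -> dcomp (did n) a = a.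
Proof.
move=> /and3P[_ _ /allP le_a]; rewrite -[RHS]map_id; apply/eq_in_map => i /le_a ai.
by rewrite nth_iota ?add0n.
Qed.

(** Both sequences are strictly increasing with the same entries. In this form the simplicial
    identities become arithmetic of [bump] and [unbump]. *)
Lemma coface_mkseq n i : (i <= n)%N -> coface n i = mkseq (bump i) n.
Proof.
move=> ni; apply: (irr_sorted_eq ltn_trans ltnn).
- exact/(sorted_filter ltn_trans)/iota_ltn_sorted.
- apply/(sortedP 0%N) => k; rewrite size_mkseq => kn.
  by rewrite !nth_mkseq ?(ltnW kn) // /bump; lia.
move=> j; rewrite mem_filter mem_iota; apply/idP/mapP => [/andP[ji jn]|[k]].
  by exists (unbump i j); rewrite ?mem_iota /bump /unbump; lia.
by rewrite mem_iota /bump => kn ->; lia.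
Qed.

Lemma mono_coface n i : (i <= n.+1)%N -> mono n n.+1 (coface n.+1 i).
Proof.
by move=> ni; rewrite coface_mkseq //; apply: mono_mkseq => [j k|]; rewrite /bump; lia.
Qed.

(** The codegeneracy [n+1] -> [n] that takes the value k twice. *)
Definition codegen n k := mkseq (unbump k) n.+2.

Lemma mono_codegen n k : (k <= n)%N -> mono n.+1 n (codegen n k).
Proof.
by move=> kn; apply: mono_mkseq => [i j|]; rewrite /unbump; lia.
Qed.

End Delta.

(** * Faces, degeneracies and the unnormalized differential *)

Section Simplicial.
Variables (K : fieldType).
Implicit Types X Y : sset K.

HB.instance Definition _ X m n a :=
  GRing.isLinear.Build K (X n) (X m) _ (sact X m n a) (@sact_lin K X m n a).
HB.instance Definition _ X n i := GRing.Linear.copy (@face K X n i) (sact X n n.+1 (coface n.+1 i)).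
HB.instance Definition _ X Y (f : smap X Y) n :=
  GRing.isLinear.Build K (X n) (Y n) _ (smap_fun f n) (@smap_lin K X Y f n).

Definition degen X n k : X n -> X n.+1 := sact X n.+1 n (codegen n k).
HB.instance Definition _ X n k := GRing.Linear.copy (@degen X n k) (sact X n.+1 n (codegen n k)).

Lemma face_face X n i j (x : X n.+2) : (i < j)%N -> (j <= n.+2)%N ->
  face i (face j x) = face j.-1 (face i x).
Proof.
move=> ij jn; rewrite /face -!sact_comp ?mono_coface //; try lia.
rewrite !coface_mkseq; try lia.
rewrite !dcomp_mkseq => [|k|k]; try by rewrite /bump; lia.
congr sact; apply: eq_mkseq => k /=; rewrite /bump; lia.
Qed.

Lemma face_degen_lt X n i k (x : X n.+1) : (i < k)%N -> (k <= n.+1)%N ->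
  face i (degen k x) = degen k.-1 (face i x).
Proof.
move=> ik kn; rewrite /face /degen -!sact_comp ?mono_coface ?mono_codegen //; try lia.
rewrite !coface_mkseq /codegen; try lia.
rewrite !dcomp_mkseq => [|l|l]; try by rewrite /bump /unbump; lia.
congr sact; apply: eq_mkseq => l /=; rewrite /bump /unbump; lia.
Qed.

Lemma face_degen_gt X n i k (x : X n.+1) : (k.+1 < i)%N -> (i <= n.+2)%N ->
  face i (degen k x) = degen k (face i.-1 x).
Proof.
move=> ik kn; rewrite /face /degen -!sact_comp ?mono_coface ?mono_codegen //; try lia.
rewrite !coface_mkseq /codegen; try lia.
rewrite !dcomp_mkseq => [|l|l]; try by rewrite /bump /unbump; lia.
congr sact; apply: eq_mkseq => l /=; rewrite /bump /unbump; lia.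
Qed.

Lemma face_degen_id X n i k (x : X n) : (k <= i <= k.+1)%N -> (k <= n)%N ->
  face i (degen k x) = x.
Proof.
move=> ik kn; rewrite /face /degen -!sact_comp ?mono_coface ?mono_codegen //; try lia.
rewrite !coface_mkseq /codegen; try lia.
rewrite !dcomp_mkseq => [|l]; try by rewrite /bump /unbump; lia.
rewrite -[RHS]sact_id did_mkseq.
congr sact; apply: eq_mkseq => l /=; rewrite /bump /unbump; lia.
Qed.

Definition bd X n : X n.+1 -> X n := @ucd K X n.+1.

Lemma bd_linear X n : linear (@bd X n).
Proof.
move=> c u v; rewrite /bd /ucd scaler_sumr -big_split; apply: eq_bigr => i _ /=.
by rewrite linearP scalerDr !scalerA mulrC.
Qed.
HB.instance Definition _ X n := GRing.isLinear.Build K (X n.+1) (X n) _ (@bd X n) (@bd_linear X n).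

Lemma smap_bd X Y (f : smap X Y) n (x : X n.+1) : f n (bd x) = bd (f n.+1 x).
Proof.
rewrite /bd /ucd linear_sum; apply: eq_bigr => -[i hi] _.
by rewrite linearZ /= /face smap_nat // mono_coface.
Qed.

(* Cancels the terms with [i <= j] against those with [j < i]. *)
Lemma alternating_double_sum (V : lmodType K) N (F : nat -> nat -> V) :
    (forall i j, (i <= j < N)%N -> F i j.+1 = - F j i) ->
  \sum_(i < N) \sum_(j < N.+1) F i j = 0.
Proof.
move=> FN.
have split i : (i < N)%N -> \sum_(j < N.+1) F i j =
    \sum_(j < N) (if (j <= i)%N then F i j else 0) -
    \sum_(j < N) (if (i <= j)%N then F j i else 0).
  move=> iN; rewrite -sumrN.
  rewrite (bigID (fun j : 'I_N.+1 => (j <= i)%N)) /=; congr (_ + _).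
    by rewrite big_mkcond big_ord_recr /= leqNgt iN addr0.
  rewrite big_mkcond big_ord_recl /= add0r; apply: eq_bigr => j _.
  rewrite /= /bump leq0n add1n -ltnNge ltnS; case: ifP => ij; last by rewrite oppr0.
  by rewrite FN // ij /=.
transitivity (\sum_(i < N) (\sum_(j < N) (if (j <= i)%N then F i j else 0) -
    \sum_(j < N) (if (i <= j)%N then F j i else 0))).
  by apply: eq_bigr => i _; rewrite split.
by rewrite big_split /= sumrN exchange_big /= subrr.
Qed.

Lemma bd_bd X n (x : X n.+2) : bd (bd x) = 0.
Proof.
pose F i j : X n := (-1) ^+ (i + j) *: face i (face j x).
transitivity (\sum_(i < n.+2) \sum_(j < n.+3) F i j).
  rewrite /bd /ucd; apply: eq_bigr => i _; rewrite linear_sum scaler_sumr.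
  by apply: eq_bigr => j _; rewrite linearZ /= scalerA -exprD.
apply: alternating_double_sum => i j /andP[ij jn].
by rewrite /F face_face //= addnS exprS mulN1r scaleNr addnC.
Qed.

End Simplicial.

(** * The Moore complex *)

Section Moore.
Variables (K : fieldType).
Implicit Types X Y : sset K.

(* [x |-> x - s_k d_k x] kills the face [k] and is homotopic to the identity on
   the elements whose faces below [k] vanish. *)
Lemma bd_degen X m k (x : X m.+1) : (k <= m)%N ->
    (forall i, (i < k)%N -> face i x = 0) ->
  bd (degen k x) + degen k (bd x) = (-1) ^+ k *: degen k (face k x).
Proof.
move=> km x0; have km2 : (k < m.+3)%N by lia.
have km1 : (k < m.+2)%N by lia.
pose U i : X m.+1 := (-1) ^+ i *: degen k (face i x).
have -> : degen k (bd x) = \sum_(i < m.+2) U i.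
  by rewrite /bd /ucd linear_sum; apply: eq_bigr => i _; rewrite linearZ.
(* Taking out the index [k] reindexes the rest by [bump k]. For [i > k] the face [i.+1] of
   [degen k x] then meets the [i]-th term of [degen k (bd x)] with the opposite sign, while [i = k]
   gives the face [k.+1], which cancels the one taken out. *)
rewrite /bd /ucd (bigD1_ord (Ordinal km2)) //= face_degen_id; try lia.
rewrite -addrA -big_split /= (bigD1 (Ordinal km1)) //= big1 => [|[i hi]].
  rewrite addr0 /bump leqnn face_degen_id; try lia.
  by rewrite add1n exprS mulN1r scaleNr addrA subrr add0r.
rewrite -val_eqE /= => ik; rewrite /U /bump; case: leqP => ki.
  by rewrite face_degen_gt ?exprS ?mulN1r ?scaleNr ?addNr //; lia.
rewrite add0n face_degen_lt //; try lia.
by rewrite x0 // !linear0 ?scaler0 addr0.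
Qed.

(** The lower faces stay zero because, for [i < k], [d_i s_k d_k x = s_(k-1) d_(k-1) d_i x]. *)
Lemma face_sub_degen X m k (x : X m.+1) : (k <= m)%N ->
    (forall i, (i < k)%N -> face i x = 0) ->
  forall i, (i <= k)%N -> face i (x - degen k (face k x)) = 0.
Proof.
move=> km x0 i; rewrite linearB leq_eqVlt => /orP[/eqP->|ik].
  by rewrite /= face_degen_id ?subrr //; lia.
case: m x km x0 => [|m] x km x0; first lia.
rewrite /= x0 // face_degen_lt // face_face //; last lia.
by rewrite x0 // !linear0 addr0.
Qed.

(** Only the faces [k] and [k.+1] survive; both equal [z], with opposite signs. *)
Lemma bd_degen_Zcyc X n k (z : X n) : (k <= n)%N -> Zcyc z -> bd (degen k z) = 0.
Proof.
move=> kn zz; have kn1 : (k < n.+1)%N by lia.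
have kn2 : (k < n.+2)%N by lia.
rewrite /bd /ucd (bigD1_ord (Ordinal kn2)) //= face_degen_id; try lia.
rewrite (bigD1 (Ordinal kn1)) //= big1 => [|[i hi]].
  rewrite addr0 /bump leqnn face_degen_id; try lia.
  by rewrite add1n exprS mulN1r scaleNr subrr.
rewrite -val_eqE /= => ik; case: n z kn zz kn1 kn2 hi => [|n] z kn zz kn1 kn2 hi; first lia.
rewrite /bump; case: leqP => ki.
  by rewrite face_degen_gt ?zz ?linear0 ?scaler0 //; lia.
by rewrite face_degen_lt ?zz ?linear0 ?scaler0 //; lia.
Qed.

Lemma Zcyc_cycle X n (z : X n) : Zcyc z -> ucd z = 0.
Proof.
case: n z => [//|n] z zz; rewrite /ucd big1 // => -[i hi] _.
by rewrite zz ?scaler0.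
Qed.

Lemma Zcyc_linear X n c (x y : X n) : Zcyc x -> Zcyc y -> Zcyc (c *: x + y).
Proof.
by case: n x y => [//|n] x y zx zy i hi; rewrite linearP /= zx // zy // scaler0 addr0.
Qed.

Lemma cycle_Zcyc X n (x : X n) : ucd x = 0 ->
  exists2 z, Zcyc z & exists y, x = z + bd y.
Proof.
case: n x => [|n] x dx; first by exists x => //; exists 0; rewrite linear0 addr0.
suff /(_ n.+1 (leqnn _)) [z [z0 dz [y ->]]] : forall k, (k <= n.+1)%N ->
    exists z : X n.+1, [/\ forall i, (i < k)%N -> face i z = 0, bd z = 0 &
      exists y, x = z + bd y].
  exists z; last by exists y.
  (* No degeneracy reaches the last face, but once the other faces vanish [bd z] is that face up to
     sign. *)
  move=> i; rewrite leq_eqVlt => /orP[/eqP->|]; last exact: z0.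
  move: dz; rewrite /bd /ucd big_ord_recr /= big1 => [|[j hj] _].
    by rewrite add0r => /(congr1 (fun v => (-1) ^+ n.+1 *: v)); rewrite signrZK scaler0.
  by rewrite z0 ?scaler0.
elim=> [_|k IHk kn]; first by exists x; split=> //; exists 0; rewrite linear0 addr0.
have [z [z0 dz [y xz]]] := IHk (ltnW kn).
have ez : degen k (face k z) = (-1) ^+ k *: bd (degen k z).
  have := @bd_degen X n k z kn z0; rewrite dz linear0 addr0 => ->.
  by rewrite signrZK.
exists (z - degen k (face k z)); split.
- exact: face_sub_degen.
- by rewrite linearB /= dz ez linearZ /= bd_bd scaler0 subr0.
exists (y + (-1) ^+ k *: degen k z).
by rewrite linearD linearZ /= -ez addrACA addNr addr0.
Qed.

(** The modification used for cycles changes [bd y] only by [bd (degen k (bd y))] up to sign, which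
    is zero since all faces of [bd y] vanish. *)
Lemma boundary_Zcyc X n (y : X n.+1) : Zcyc (bd y) ->
  exists2 y', bd y' = bd y & forall i, (i <= n)%N -> face i y' = 0.
Proof.
move=> zy; suff /(_ n.+1 (leqnn _)) [y' y'0 dy'] : forall k, (k <= n.+1)%N ->
    exists2 y' : X n.+1, forall i, (i < k)%N -> face i y' = 0 & bd y' = bd y.
  by exists y'.
elim=> [_|k IHk kn]; first by exists y.
have [y' y'0 dy'] := IHk (ltnW kn).
exists (y' - degen k (face k y')); first exact: face_sub_degen.
have ey : degen k (face k y') = (-1) ^+ k *: (bd (degen k y') + degen k (bd y')).
  by rewrite bd_degen // signrZK.
rewrite linearB /= ey linearZ /= linearD /= bd_bd dy' bd_degen_Zcyc //.
by rewrite addr0 scaler0 subr0.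
Qed.

(** When the faces of [y] below [n] vanish, [bd y] is the difference of the last two faces up to
    sign; so homotopy classes are homology classes of the Moore cycles. *)
Lemma htpcP X n (x x' : X n) : Zcyc x -> Zcyc x' ->
  htpc x x' <-> exists y, x' = x + bd y.
Proof.
have bdE (y : X n.+1) : (forall i, (i < n)%N -> face i y = 0) ->
    bd y = (-1) ^+ n *: (face n y - face n.+1 y).
  move=> y0; rewrite /bd /ucd !big_ord_recr /= big1 => [|[i hi] _].
    by rewrite add0r exprS mulN1r scaleNr scalerBr.
  by rewrite y0 ?scaler0.
move=> zx zx'; split=> [[y [y0 [yx yx']]]|[y xy]].
  exists ((-1) ^+ n.+1 *: y); rewrite linearZ /= bdE // yx yx' exprS mulN1r scaleNr.
  by rewrite signrZK opprB addrC subrK.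
have [|y' dy' y'0] := @boundary_Zcyc X n y.
  have -> : bd y = (-1) *: x + x' by rewrite xy scaleN1r addKr.
  exact: Zcyc_linear.
have e : bd y = (-1) ^+ n.+1 *: face n.+1 y'.
  rewrite -dy' bdE => [|i hi]; last by apply: y'0; apply: ltnW.
  by rewrite y'0 // sub0r exprS mulN1r scaleNr scalerN.
(* [degen n x] has both last faces equal to [x]; [y'] contributes only to the face [n.+1], where the
   sign makes its contribution [bd y]. *)
exists ((-1) ^+ n.+1 *: y' + degen n x); split=> [i hi|].
  rewrite linearP /= y'0 ?(ltnW hi) // scaler0 add0r.
  case: n x hi zx {bdE zx' y y' xy dy' y'0 e x'} => // n x hi zx.
  by rewrite face_degen_lt // zx ?linear0 //; lia.
split; first by rewrite linearP /= y'0 // scaler0 add0r face_degen_id //; lia.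
by rewrite linearP /= -e face_degen_id; [rewrite addrC -xy|lia|].
Qed.

Lemma smap_Zcyc X Y (f : smap X Y) n (x : X n) : Zcyc x -> Zcyc (f n x).
Proof.
case: n x => [//|n] x zx i hi; rewrite /face -smap_nat ?mono_coface //.
by have := zx i hi; rewrite /face => ->; rewrite linear0.
Qed.

Lemma Zcyc0 X n : Zcyc (0 : X n).
Proof. by case: n => [//|n] i _; rewrite linear0. Qed.

(** Cycles are replaced by homologous elements of [Zcyc], and [decompose] carries the correction
    through [f]. Injectivity on [pi_n] compares two elements and on homology one element with zero,
    hence the uses of [0] and of [x' - x]. *)
Lemma pi_iso_quasi_iso X Y (f : smap X Y) :
  (forall n, pi_iso f n) <-> quasi_iso f.
Proof.
have decompose n (x : X n) (y' : Y n.+1) z y w : x = z + bd y -> f n x = w + bd y' ->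
    f n z = w + bd (y' - f n.+1 y).
  by move=> ->; rewrite linearD linearB /= smap_bd addrA => <-; rewrite addrK.
split=> [pif n|qf n].
  have [inj surj] := pif n; split=> [x dx [y' ey']|z dz].
    have [z zz [y xzy]] := cycle_Zcyc dx.
    have fz : f n z = 0 + bd (y' - f n.+1 y).
      by apply: (decompose _ x); rewrite ?add0r.
    have : htpc 0 z.
      apply: inj => //; first exact: Zcyc0.
      rewrite linear0; apply/htpcP; [exact: Zcyc0|exact: smap_Zcyc|].
      by exists (y' - f n.+1 y).
    case/htpcP => [||w]; [exact: Zcyc0|by []|rewrite add0r => zw].
    by exists (w + y); rewrite -/(bd _) linearD /= -zw -xzy.
  have [z0 zz0 [y0 ez]] := cycle_Zcyc dz.
  have [x [zx]] := surj z0 zz0; case/htpcP => [||w ew]; [exact: smap_Zcyc|by []|].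
  exists x; split; first exact: Zcyc_cycle.
  by exists (- y0 - w); rewrite -/(bd _) linearB linearN /= ez ew addrA addrK addrK.
have [inj surj] := qf n; split=> [x x' zx zx'|z zz].
  case/htpcP => [||y ey]; [exact: smap_Zcyc..|].
  have [||w dw] := inj (x' - x).
  - by apply: Zcyc_cycle; rewrite addrC -scaleN1r; apply: Zcyc_linear.
  - by exists y; rewrite linearB /= ey addrC addKr.
  by apply/htpcP => //; exists w; rewrite addrC -[bd w]/(ucd w) dw subrK.
have [x [dx [y' ey']]] := surj z (Zcyc_cycle zz).
have [x0 zx0 [y exy]] := cycle_Zcyc dx.
exists x0; split => //; apply/htpcP => //; first exact: smap_Zcyc.
exists (- (y' - f n.+1 y)).
by rewrite (decompose _ _ _ _ _ _ exy ey') linearN addrK.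
Qed.

End Moore.

(** * Chains in the simplex category *)

Section Chains.

Definition lobj (c : chain) : nat := last c.1 c.2.1.

(** Chains grow at the end away from [b_0], so the coefficient space X(b_0) stays the same. *)
Definition extc (c : chain) (q : nat) (a : seq nat) : chain :=
  (c.1, (rcons c.2.1 q, rcons c.2.2 a)).

Lemma lobj_extc c q a : lobj (extc c q a) = q.
Proof. by rewrite /lobj /= last_rcons. Qed.

Lemma valid_extc p c q a : valid p.+1 (extc c q a) = valid p c && mono q (lobj c) a.
Proof.
rewrite /valid (_ : iota 0 p.+1 = iota 0 p ++ [:: p]); last by rewrite -addn1 iotaD.
rewrite all_cat /= andbT !size_rcons !eqSS; case: eqP => // s1; case: eqP => //= s2.
congr (_ && _).
  apply: eq_in_all => i; rewrite mem_iota add0n /= => ip.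
  by rewrite /cobjs /cmaps /= -rcons_cons !nth_rcons /= s1 s2 ip leqW.
rewrite /cobjs /cmaps !nth_rcons s1 s2 ltnn eqxx /= -rcons_cons nth_rcons /= s1 ltnSn.
by rewrite -[X in nth _ _ X]s1 (nth_last _ (c.1 :: c.2.1)).
Qed.

Lemma validS p c : valid p.+1 c ->
  exists c' q a, [/\ c = extc c' q a, valid p c' & mono q (lobj c') a].
Proof.
move=> vc; case: c vc => b0 [bs fs] vc.
have /and3P[/= /eqP sb /eqP sf _] := vc.
case/lastP: bs sb vc => // bs q _; case/lastP: fs sf => // fs a _ vc.
exists (b0, (bs, fs)), q, a; split=> //.
  by move: vc; rewrite (@valid_extc p (b0, (bs, fs)) q a) => /andP[].
by move: vc; rewrite (@valid_extc p (b0, (bs, fs)) q a) => /andP[].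
Qed.

Lemma valid0 c : valid 0 c -> c = (c.1, ([::], [::])).
Proof. by case: c => b [[|? ?] [|? ?]]. Qed.

Definition barix p q : pred (chain * seq nat) :=
  [pred i | valid p i.1 && mono q (lobj i.1) i.2].

(* The map [q] -> b_p of an index of the bar bicomplex after the face dropping
   b_(i+1) has been applied to its chain of length p.+1. *)
Definition amend (p i : nat) (c : chain) (a : seq nat) : seq nat :=
  if (i < p)%N then a else dcomp (last [::] c.2.2) a.

(** The last face of [c] drops its final map, but in the extended chain it is an inner face that
    composes this map with [a]; [amend] accounts for the difference. *)
Lemma cface_extc p i c q a : valid p.+1 c -> (i < p.+1)%N ->
  cface p.+2 i (extc c q a) = extc (cface p.+1 i c) q (amend p i c a).
Proof.
case: c => b [bs fs] /and3P[/= /eqP sb /eqP sf _] ip.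
rewrite /cface /extc /amend /= ltnS ip ltnS; congr (_, (_, _)).
  rewrite rcons_cat -!cats1 take_cat sb ip drop_cat sb.
  case: ltnP => // ip'; have -> : i = p by lia.
  by rewrite subnn [drop p.+1 bs]drop_oversize ?sb ?cats0 -?catA.
rewrite -!cats1 take_cat sf ip nth_cat sf ip nth_cat sf drop_cat sf.
case: (ltngtP i p) => ip'; last 1 first.
- subst i; rewrite ltnn subnn /= ltnNge leqnSn /= subSnn /=.
  by rewrite -nth_last sf.
- rewrite ltnS ip' -catA /=; congr (_ ++ _ :: _); case: ltnP => // ip''.
  have -> : i.+2 = p.+1 by lia.
  by rewrite subnn /= drop_oversize // sf.
by lia.
Qed.

Lemma cface_extc_last p c q a : valid p c -> cface p.+1 p (extc c q a) = c.
Proof.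
case: c => b [bs fs] /and3P[/= /eqP sb /eqP sf _]; rewrite /cface /extc /= ltnn.
rewrite -!cats1 !take_cat drop_cat sb sf ltnn subnn ltnNge leqnSn /= subSnn /=.
by rewrite !cats0.
Qed.

Lemma cface0_extc p c q a : valid p.+1 c -> cface0 (extc c q a) = extc (cface0 c) q a.
Proof. by case: c => b [[|b1 bs] [|f fs]] // /and3P[]. Qed.

Lemma lobj_cface0 p c : valid p.+1 c -> lobj (cface0 c) = lobj c.
Proof. by case: c => b [[|b1 bs] fs]. Qed.

Lemma valid_cface0 p c : valid p.+1 c -> valid p (cface0 c).
Proof.
elim: p c => [|p IHp] c /validS[c' [q [a [-> vc' qa]]]].
  by rewrite (valid0 vc').
rewrite (cface0_extc _ _ vc') valid_extc IHp //=.
by rewrite (lobj_cface0 vc').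
Qed.

Lemma barix_cface0 p q c a : barix p.+1 q (c, a) -> barix p q (cface0 c, a).
Proof.
by move=> /andP[/= vc ca]; rewrite /barix /= valid_cface0 // (lobj_cface0 vc).
Qed.

Lemma barix_cface p q i c a : barix p.+1 q (c, a) -> (i < p.+1)%N ->
  barix p q (cface p.+1 i c, amend p i c a).
Proof.
elim: p q i c a => [|p IHp] q i c a /andP[/= /validS[c' [b [f [-> vc' bf]]]]];
  rewrite lobj_extc => qa; rewrite ltnS leq_eqVlt => /orP[/eqP->|ip] //.
- by rewrite cface_extc_last // /barix /amend /= vc' last_rcons (mono_dcomp bf).
- rewrite cface_extc_last // /barix /amend /= vc' ltnn last_rcons.
  exact: (mono_dcomp bf).
rewrite cface_extc // {2}/amend ip /barix /= lobj_extc qa valid_extc andbT.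
by have := IHp b i c' f; rewrite /barix /= vc' bf; apply.
Qed.

Lemma valid_cface p i c : valid p.+1 c -> (i < p.+1)%N -> valid p (cface p.+1 i c).
Proof.
move=> vc ip.
(* Every object has a vertex 0, so any valid chain extends to an index of the double complex, to
   which [barix_cface] applies. *)
have : barix p.+1 0 (c, [:: 0%N]) by rewrite /barix /= vc.
by move=> /barix_cface/(_ ip)/andP[].
Qed.

Lemma barix_extc p q c a : barix p q (c, a) -> barix p.+1 q (extc c q a, did q).
Proof. by rewrite /barix /= valid_extc lobj_extc mono_did andbT. Qed.

Lemma barix_dcomp p m n c a b : barix p n (c, a) -> mono m n b ->
  barix p m (c, dcomp a b).
Proof.
by rewrite /barix /= => /andP[-> ca] ab /=; apply: mono_dcomp ab.
Qed.

End Chains.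

(** * The bar double complex *)

Section BarModules.
Variables (K : fieldType).
Implicit Types X Y : sset K.

Definition bar X p : lmodType K := dsum (valid p) (fun c => X (chd c)).

(* D_(p,q): the sum of X(b_0) over the p-chains extended by a map [q] -> b_p. *)
Definition barD X p q : lmodType K := dsum (barix p q) (fun i => X (chd i.1)).

Definition bgen X p (c : chain) (v : X (chd c)) : bar X p :=
  @gen K _ (valid p) (fun c => X (chd c)) c v.

Definition Dgen X p q (c : chain) (a : seq nat) (v : X (chd c)) : barD X p q :=
  @gen K _ (barix p q) (fun i => X (chd i.1)) (c, a) v.

HB.instance Definition _ X p c := GRing.isLinear.Build K (X (chd c)) (bar X p) _
  (@bgen X p c) (@gen_linear K _ (valid p) (fun c => X (chd c)) c).
HB.instance Definition _ X p q c a := GRing.isLinear.Build K (X (chd c)) (barD X p q) _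
  (@Dgen X p q c a) (@gen_linear K _ (barix p q) (fun i => X (chd i.1)) (c, a)).

(** With the head [b] shared, [v] needs no transport between the two chains; all bar faces but the
    first keep the head. *)
Lemma Dgen_tail X p q b (s s' : seq nat * seq (seq nat)) a a' (v : X b) :
    (b, s) = (b, s') :> chain -> a = a' ->
  @Dgen X p q (b, s) a v = @Dgen X p q (b, s') a' v.
Proof. by case=> -> ->. Qed.

Lemma barD_ext X p q (V : lmodType K) (g h : barD X p q -> V) :
    linear g -> linear h ->
    (forall c a (v : X (chd c)), barix p q (c, a) -> g (Dgen p q a v) = h (Dgen p q a v)) ->
  forall u, g u = h u.
Proof. by move=> lg lh e; apply: dsum_ext => // -[c a] v; apply: e. Qed.

Definition Dlift X p q (V : lmodType K) (G : forall c, seq nat -> X (chd c) -> V) :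
  barD X p q -> V := dlift (fun i v => G i.1 i.2 v).

Lemma Dlift_linear X p q (V : lmodType K) (G : forall c, seq nat -> X (chd c) -> V) :
  (forall c a, barix p q (c, a) -> linear (G c a)) -> linear (@Dlift X p q V G).
Proof. by move=> lG; apply: dlift_linear => -[c a]; apply: lG. Qed.

Lemma Dlift_gen X p q (V : lmodType K) (G : forall c, seq nat -> X (chd c) -> V) :
    (forall c a, barix p q (c, a) -> linear (G c a)) ->
  forall c a (v : X (chd c)), barix p q (c, a) -> Dlift G (Dgen p q a v) = G c a v.
Proof.
move=> lG c a v ca; rewrite /Dlift /Dgen dlift_gen // => -[c' a']; exact: lG.
Qed.

Lemma linear_comp_fun (U V W : lmodType K) (g : V -> W) (h : U -> V) :
  linear g -> linear h -> linear (fun u => g (h u)).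
Proof. by move=> lg lh c u v; rewrite lh lg. Qed.

Lemma linear_zero_fun (U V : lmodType K) : linear (fun _ : U => 0 : V).
Proof. by move=> c u v; rewrite /= scaler0 addr0. Qed.

Lemma linear_add_fun (U V : lmodType K) (g h : U -> V) :
  linear g -> linear h -> linear (fun u => g u + h u).
Proof. by move=> lg lh c u v; rewrite lg lh scalerDr addrACA. Qed.

Lemma linear_scale_fun (U V : lmodType K) (a : K) (g : U -> V) :
  linear g -> linear (fun u => a *: g u).
Proof. by move=> lg c u v; rewrite lg scalerDr !scalerA mulrC. Qed.

Lemma linear_sum_fun (U V : lmodType K) (T : Type) (s : seq T) (g : T -> U -> V) :
  (forall t, linear (g t)) -> linear (fun u => \sum_(t <- s) g t u).
Proof.
move=> lg c u v; rewrite scaler_sumr -big_split; apply: eq_bigr => t _; exact: lg.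
Qed.

Definition Dact X p m n (b : seq nat) : barD X p n -> barD X p m :=
  Dlift (fun c a v => Dgen p m (dcomp a b) v).

Lemma Dact_linear X p m n b : linear (@Dact X p m n b).
Proof. by apply: Dlift_linear => c a _ k u v; rewrite linearP. Qed.

Lemma Dact_gen X p m n b c a (v : X (chd c)) : barix p n (c, a) ->
  Dact m b (Dgen p n a v) = Dgen p m (dcomp a b) v.
Proof. by move=> ca; rewrite /Dact Dlift_gen // => ? ? _ k u w; rewrite linearP. Qed.

Fact barS_id X p n (u : barD X p n) : Dact n (did n) u = u.
Proof.
move: u; apply: (barD_ext (h := id)) => [||c a v ca]; [exact: Dact_linear|by []|].
by rewrite Dact_gen //; case/andP: ca => _ /dcomp_did->.
Qed.

Fact barS_comp X p l m n a b (u : barD X p n) : mono m n a -> mono l m b ->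
  Dact l (dcomp a b) u = Dact l b (Dact m a u).
Proof.
move=> ha hb; move: u; apply: barD_ext => [||c f v cf].
- exact: Dact_linear.
- by apply: linear_comp_fun; apply: Dact_linear.
rewrite !Dact_gen //; last exact: barix_dcomp ha.
by rewrite (dcompA _ ha hb).
Qed.

(** The [p]-th term of the bar resolution as a simplicial vector space. Its unnormalized complex is
    the [p]-th column, so [bd_bd] and [smap_bd] provide the relations that involve the vertical
    differential. *)
Definition barS X p : sset K :=
  @SSet K (fun q => barD X p q) (fun m n b => Dact m b)
    (fun m n b => @Dact_linear X p m n b) (@barS_id X p) (@barS_comp X p).

(* Horizontal differential: all bar faces, the last one also recomposing the
   extra map. *)
Definition hgen X p q (c : chain) (a : seq nat) (v : X (chd c)) : barD X p q :=
  Dgen p q (c := cface0 c) a (sact X (chd (cface0 c)) (chd c) (head [::] c.2.2) v) +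
  \sum_(i <- iota 0 p.+1)
    Dgen p q (c := cface p.+1 i c) (amend p i c a) ((-1) ^+ i.+1 *: v).

Lemma hgen_linear X p q c a : linear (@hgen X p q c a).
Proof.
apply: linear_add_fun; first by move=> k u v; rewrite !linearP.
by apply: linear_sum_fun => i k u v; rewrite scalerDr scalerA mulrC -scalerA linearP.
Qed.

Definition hdiff X p q : barD X p.+1 q -> barD X p q := Dlift (@hgen X p q).

Lemma hdiff_linear X p q : linear (@hdiff X p q).
Proof. by apply: Dlift_linear => c a _; apply: hgen_linear. Qed.
HB.instance Definition _ X p q :=
  GRing.isLinear.Build K (barD X p.+1 q) (barD X p q) _ (@hdiff X p q) (@hdiff_linear X p q).

Lemma hdiff_gen X p q c a (v : X (chd c)) : barix p.+1 q (c, a) ->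
  hdiff (Dgen p.+1 q a v) = hgen p q a v.
Proof. by move=> ca; rewrite /hdiff Dlift_gen // => *; apply: hgen_linear. Qed.

Lemma amend_extc p c q a b : amend p p (extc c q a) b = dcomp a b.
Proof. by rewrite /amend ltnn /= last_rcons. Qed.

Lemma amend_dcomp p i c a b m n : barix p.+1 n (c, a) -> mono m n b ->
  amend p i c (dcomp a b) = dcomp (amend p i c a) b.
Proof.
by move=> /andP[_ /= ca] nb; rewrite /amend; case: ifP => // _; rewrite (dcompA _ ca nb).
Qed.

Fact hdiff_nat X p m n b (u : barS X p.+1 n) : mono m n b ->
  hdiff (sact (barS X p.+1) m n b u) = sact (barS X p) m n b (hdiff u).
Proof.
move=> nb; move: u; apply: barD_ext => [||c a v ca].
- by apply: linear_comp_fun; [apply: hdiff_linear|apply: Dact_linear].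
- by apply: linear_comp_fun; [apply: Dact_linear|apply: hdiff_linear].
rewrite /= Dact_gen // !hdiff_gen //; last exact: barix_dcomp nb.
rewrite /hgen (linear_funD _ _ (@Dact_linear X p m n b)).
rewrite (linear_fun_sum _ _ (@Dact_linear X p m n b)) Dact_gen; last exact: barix_cface0 ca.
congr (_ + _); rewrite big_seq [RHS]big_seq; apply: eq_bigr => i.
rewrite mem_iota add0n /= => ip.
by rewrite Dact_gen; [rewrite (amend_dcomp _ ca nb)|apply: barix_cface ca ip].
Qed.

Definition hmap X p : smap (barS X p.+1) (barS X p) :=
  @SMap K (barS X p.+1) (barS X p) (@hdiff X p) (@hdiff_linear X p) (@hdiff_nat X p).

Definition Daug X q : barD X 0 q -> X q := Dlift (fun c a v => sact X q (chd c) a v).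

Lemma Daug_linear X q : linear (@Daug X q).
Proof. by apply: Dlift_linear => c a _ k u v; rewrite linearP. Qed.
HB.instance Definition _ X q :=
  GRing.isLinear.Build K (barD X 0 q) (X q) _ (@Daug X q) (@Daug_linear X q).

Lemma Daug_gen X q c a (v : X (chd c)) : barix 0 q (c, a) ->
  Daug (Dgen 0 q a v) = sact X q (chd c) a v.
Proof. by move=> ca; rewrite /Daug Dlift_gen // => ? ? _ k u w; rewrite linearP. Qed.

Lemma barix0 q c a : barix 0 q (c, a) -> mono q (chd c) a.
Proof. by move=> /andP[/= /valid0->]. Qed.

Fact Daug_nat X m n b (u : barS X 0 n) : mono m n b ->
  Daug (sact (barS X 0) m n b u) = sact X m n b (Daug u).
Proof.
move=> nb; move: u; apply: barD_ext => [||c a v ca].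
- by apply: linear_comp_fun; [apply: Daug_linear|apply: Dact_linear].
- by apply: linear_comp_fun; [apply: sact_lin|apply: Daug_linear].
rewrite /= Dact_gen // !Daug_gen //; last exact: barix_dcomp nb.
exact: sact_comp (barix0 ca) nb.
Qed.

Definition augmap X : smap (barS X 0) X :=
  @SMap K (barS X 0) X (@Daug X) (@Daug_linear X) (@Daug_nat X).

Lemma Daug_hdiff X q (u : barD X 1 q) : Daug (hdiff u) = 0.
Proof.
move: u; apply: (barD_ext (h := fun=> 0)) => [||c a v ca].
- by apply: linear_comp_fun; [apply: Daug_linear|apply: hdiff_linear].
- exact: linear_zero_fun.
rewrite hdiff_gen // /hgen /= big_seq1 linearD /=.
rewrite !Daug_gen; [|exact: (@barix_cface 0 q 0 c a)|exact: barix_cface0 ca].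
rewrite expr1 scaleN1r linearN /= /amend ltnn.
have /andP[/= vc] := ca.
case/validS: vc v => c' [b [f [-> vc' bf]]] v; rewrite lobj_extc => qa.
move: v bf; rewrite (valid0 vc') /= => v bf.
by rewrite (@sact_comp K X _ _ _ _ _ v bf qa) subrr.
Qed.

Definition hhtpy X p q : barD X p q -> barD X p.+1 q :=
  Dlift (fun c a v => Dgen p.+1 q (c := extc c q a) (did q) v).

Lemma hhtpy_linear X p q : linear (@hhtpy X p q).
Proof. by apply: Dlift_linear => c a _ k u v; rewrite linearP. Qed.

Lemma hhtpy_gen X p q c a (v : X (chd c)) : barix p q (c, a) ->
  hhtpy (Dgen p q a v) = Dgen p.+1 q (c := extc c q a) (did q) v.
Proof. by move=> ca; rewrite /hhtpy Dlift_gen // => ? ? _ k u w; rewrite linearP. Qed.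

Definition hsec X q (x : X q) : barD X 0 q :=
  @Dgen X 0 q (q, ([::], [::])) (did q) x.

Lemma hsec_linear X q : linear (@hsec X q).
Proof. by move=> c u v; rewrite /hsec linearP. Qed.

Lemma Daug_hsec X q (x : X q) : Daug (hsec x) = x.
Proof. by rewrite Daug_gen ?sact_id // /barix /= mono_did. Qed.

Lemma hdiff_hhtpy0 X q (u : barD X 0 q) : hdiff (hhtpy u) = hsec (Daug u) - u.
Proof.
move: u; apply: barD_ext => [||c a v ca].
- by apply: linear_comp_fun; [apply: hdiff_linear|apply: hhtpy_linear].
- apply: linear_add_fun.
    by apply: linear_comp_fun; [apply: hsec_linear|apply: Daug_linear].
  by move=> k u v; rewrite opprD scalerN.
rewrite hhtpy_gen // hdiff_gen ?barix_extc // Daug_gen // /hgen /= big_seq1.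
have /andP[/= vc mc] := ca.
rewrite expr1 scaleN1r linearN; congr (_ - _); first by move: v; rewrite (valid0 vc).
case: c v vc mc {ca} => b s v vc mc; apply: Dgen_tail; first exact: cface_extc_last.
by rewrite amend_extc (dcomp_did mc).
Qed.

(** All faces but the new last one commute with extending the chain. The last one composes [a] with
    the identity and returns [u] with the sign [(-1) ^+ p.+2]. *)
Lemma hdiff_hhtpy X p q (u : barD X p.+1 q) :
  hdiff (hhtpy u) = hhtpy (hdiff u) + (-1) ^+ p *: u.
Proof.
move: u; apply: barD_ext => [||c a v ca].
- by apply: linear_comp_fun; [apply: hdiff_linear|apply: hhtpy_linear].
- apply: linear_add_fun; last exact: linear_scale_fun.
  by apply: linear_comp_fun; [apply: hhtpy_linear|apply: hdiff_linear].
have /andP[/= vc mc] := ca.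
rewrite hhtpy_gen // !hdiff_gen ?barix_extc // /hgen.
rewrite (linear_funD _ _ (@hhtpy_linear X p q)).
rewrite (linear_fun_sum _ _ (@hhtpy_linear X p q)) hhtpy_gen; last exact: barix_cface0 ca.
rewrite -addrA; congr (_ + _).
  by case: c v vc {ca mc} => b [[|b1 bs] [|f fs]] v // /and3P[].
rewrite (_ : iota 0 p.+2 = iota 0 p.+1 ++ [:: p.+1]); last by rewrite -addn1 iotaD.
rewrite big_cat big_seq1; congr (_ + _); last first.
  rewrite !exprS mulrA mulrNN !mul1r -linearZ /=.
  case: c v vc mc {ca} => b s v vc mc; apply: Dgen_tail; first exact: cface_extc_last.
  by rewrite amend_extc (dcomp_did mc).
rewrite big_seq [RHS]big_seq; apply: eq_bigr => i; rewrite mem_iota add0n /= => ip.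
rewrite hhtpy_gen; last exact: barix_cface.
by apply: Dgen_tail; [exact: cface_extc|rewrite /amend ip].
Qed.

(* Every generator is pulled back from one in the image of the contraction, so
   that no simplicial identity for the bar faces is needed. *)
Lemma hdiff_hdiff X p q (u : barD X p.+2 q) : hdiff (hdiff u) = 0.
Proof.
have reduce p' : (forall b (w : barD X p'.+1 b), hdiff (hdiff (hhtpy w)) = 0) ->
    forall q (u : barD X p'.+2 q), hdiff (hdiff u) = 0.
  move=> dd0 q'; apply: (barD_ext (h := fun=> 0)) => [||c a v ca].
  - by apply: linear_comp_fun; apply: hdiff_linear.
  - exact: linear_zero_fun.
  have /andP[/= vc] := ca.
  case/validS: vc v ca => c' [b [f [-> vc' bf]]] v ca; rewrite lobj_extc => qa.
  have c'f : barix p'.+1 b (c', f) by rewrite /barix /= vc'.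
  have -> : Dgen p'.+2 q' a v =
      sact (barS X p'.+2) q' b a (hhtpy (@Dgen X p'.+1 b c' f v)).
    by rewrite hhtpy_gen //= Dact_gen ?barix_extc // (did_dcomp qa).
  rewrite (hdiff_nat _ qa) [LHS](@hdiff_nat X p' q' b a _ qa).
  by rewrite dd0; apply: linear_fun0 (@Dact_linear X p' q' b a).
elim: p q u => [|p IHp]; apply: reduce => b w; rewrite hdiff_hhtpy linearD /=.
  rewrite hdiff_hhtpy0 Daug_hdiff (linear_fun0 (@hsec_linear X b)) sub0r.
  by rewrite expr0 scale1r addNr.
rewrite hdiff_hhtpy IHp (linear_fun0 (@hhtpy_linear X p b)) add0r linearZ /=.
by rewrite exprS mulN1r scaleNr subrr.
Qed.

Definition vhtpy X p q : barD X p q -> barD X p q.+1 :=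
  Dlift (fun c a v => Dgen p q.+1 (0%N :: a) v).

Lemma vhtpy_linear X p q : linear (@vhtpy X p q).
Proof. by apply: Dlift_linear => c a _ k u v; rewrite linearP. Qed.

Lemma vhtpy_gen X p q c a (v : X (chd c)) : barix p q (c, a) ->
  vhtpy (Dgen p q a v) = Dgen p q.+1 (0%N :: a) v.
Proof. by move=> ca; rewrite /vhtpy Dlift_gen // => ? ? _ k u w; rewrite linearP. Qed.

Lemma barix_cons p q c a : barix p q (c, a) -> barix p q.+1 (c, 0%N :: a).
Proof.
rewrite /barix /= => /andP[-> /= /and3P[sa so le]]; apply/and3P; split=> //.
by rewrite /= path_min_sorted //; apply/allP.
Qed.

Lemma dcomp_cons_coface0 q a : size a = q.+1 -> dcomp (0%N :: a) (coface q.+1 0) = a.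
Proof.
move=> sa; rewrite coface_mkseq // /dcomp /mkseq -map_comp -[RHS](mkseq_nth 0%N) sa.
by apply/eq_in_map => i _.
Qed.

Lemma dcomp_cons_cofaceS q a i : (i <= q.+1)%N ->
  dcomp (0%N :: a) (coface q.+2 i.+1) = 0%N :: dcomp a (coface q.+1 i).
Proof.
move=> iq; rewrite !coface_mkseq // /dcomp /mkseq -!map_comp.
rewrite (_ : iota 0 q.+2 = 0%N :: map S (iota 0 q.+1)); last by rewrite -(iotaDl 1 0).
rewrite map_cons -map_comp; congr (_ :: _).
by apply/eq_in_map => k _ /=; rewrite /bump ltnS addnS.
Qed.

(** Tensoring with the trivial module identifies all vertices [0] -> b_p, so the projection forgets
    [a]. *)
Definition coaug X p : barD X p 0 -> bar X p := Dlift (fun c a v => bgen p v).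

Lemma coaug_linear X p : linear (@coaug X p).
Proof. by apply: Dlift_linear => c a _ k u v; rewrite linearP. Qed.
HB.instance Definition _ X p :=
  GRing.isLinear.Build K (barD X p 0) (bar X p) _ (@coaug X p) (@coaug_linear X p).

Lemma coaug_gen X p c a (v : X (chd c)) : barix p 0 (c, a) ->
  coaug (Dgen p 0 a v) = bgen p v.
Proof. by move=> ca; rewrite /coaug Dlift_gen // => ? ? _ k u w; rewrite linearP. Qed.

Definition cosec X p : bar X p -> barD X p 0 := dlift (fun c v => Dgen p 0 [:: 0%N] v).

Lemma cosec_linear X p : linear (@cosec X p).
Proof. by apply: dlift_linear => c _ k u v; rewrite linearP. Qed.

Lemma cosec_gen X p c (v : X (chd c)) : valid p c ->
  cosec (bgen p v) = Dgen p 0 [:: 0%N] v.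
Proof. by move=> vc; rewrite /cosec dlift_gen // => ? _ k u w; rewrite linearP. Qed.

Lemma coaug_cosec X p (s : bar X p) : coaug (cosec s) = s.
Proof.
move: s; apply: (dsum_ext (h := id)) => [||c v vc]; [|by []|].
  by apply: linear_comp_fun; [apply: coaug_linear|apply: cosec_linear].
by rewrite [cosec _]cosec_gen // coaug_gen //= /barix /= vc.
Qed.

Lemma bd_vhtpy0 X p (u : barD X p 0) :
  @bd K (barS X p) 0 (vhtpy u) = u - cosec (coaug u).
Proof.
move: u; apply: barD_ext => [||c a v ca].
- by apply: linear_comp_fun; [exact: (@bd_linear K (barS X p))|exact: vhtpy_linear].
- apply: linear_add_fun => //.
  have lN : linear (fun u : barD X p 0 => - u) by move=> k u v; rewrite opprD scalerN.
  apply: (linear_comp_fun (g := -%R)) => //.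
  by apply: linear_comp_fun; [apply: cosec_linear|apply: coaug_linear].
have /andP[/= vc /and3P[/eqP sa _ _]] := ca.
rewrite vhtpy_gen // coaug_gen // cosec_gen // /bd /ucd !big_ord_recr big_ord0 /= add0r.
rewrite !Dact_gen ?barix_cons //= expr0 scale1r expr1 scaleN1r.
by case: a sa {ca} => [|x [|]].
Qed.

(** Face 0 removes the cone vertex and returns [u]; face [i.+1] of the cone is the cone on face [i],
    with the sign changed. *)
Lemma bd_vhtpy X p q (u : barD X p q.+1) :
  @bd K (barS X p) q.+1 (vhtpy u) = u - vhtpy (@bd K (barS X p) q u).
Proof.
move: u; apply: barD_ext => [||c a v ca].
- by apply: linear_comp_fun; [exact: (@bd_linear K (barS X p))|exact: vhtpy_linear].
- apply: linear_add_fun => //.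
  have lN : linear (fun u : barD X p q.+1 => - u) by move=> k u v; rewrite opprD scalerN.
  apply: (linear_comp_fun (g := -%R)) => //.
  by apply: linear_comp_fun; [exact: vhtpy_linear|exact: (@bd_linear K (barS X p))].
have /andP[/= vc /and3P[/eqP sa _ _]] := ca.
rewrite vhtpy_gen // /bd /ucd (linear_fun_sum _ _ (@vhtpy_linear X p q)).
rewrite big_ord_recl /= Dact_gen ?barix_cons // dcomp_cons_coface0 //.
rewrite expr0 scale1r -sumrN; congr (_ + _); apply: eq_bigr => -[i hi] _.
rewrite /= /bump leq0n add1n !Dact_gen ?barix_cons //.
rewrite (linear_funZ _ _ (@vhtpy_linear X p q)) vhtpy_gen.
  by rewrite dcomp_cons_cofaceS // exprS mulN1r scaleNr.
by apply: (barix_dcomp ca); apply: mono_coface.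
Qed.

Lemma coaug_bd X p (u : barD X p 1) : coaug (@bd K (barS X p) 0 u) = 0.
Proof.
move: u; apply: (barD_ext (h := fun=> 0)) => [||c a v ca].
- by apply: linear_comp_fun; [exact: coaug_linear|exact: (@bd_linear K (barS X p))].
- exact: linear_zero_fun.
rewrite /bd /ucd !big_ord_recr big_ord0 /= add0r !Dact_gen // linearD !linearZ /=.
have ci i : (i <= 1)%N -> barix p 0 (c, dcomp a (coface 1 i)).
  by move=> i1; apply: barix_dcomp ca (mono_coface i1).
rewrite !coaug_gen; [|exact: (ci 1%N)|exact: (ci 0%N)].
by rewrite expr0 scale1r expr1 scaleN1r subrr.
Qed.

Lemma sum_dterm X p (V : lmodType K) (F : term X -> V) c (v : X (chd c)) :
  \sum_(t <- dterm p (tmk v)) F t =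
  F (@tmk K X (cface0 c) (sact X (chd (cface0 c)) (chd c) (head [::] c.2.2) v)) +
  \sum_(i <- iota 0 p.+1) F (@tmk K X (cface p.+1 i c) ((-1) ^+ i.+1 *: v)).
Proof. by rewrite /dterm big_cons big_map. Qed.

(** Built from [dterm] itself, so that [tsum] intertwines [bar_d] with this map. *)
Definition bar_diff X p : bar X p.+1 -> bar X p :=
  dlift (fun c v => \sum_(t <- dterm p (@tmk K X c v)) bgen p (tagged t)).

Lemma bar_diff_gen_linear X p c :
  linear (fun v => \sum_(t <- dterm p (@tmk K X c v)) bgen p (tagged t)).
Proof.
pose g v : bar X p :=
  @bgen X p (cface0 c) (sact X (chd (cface0 c)) (chd c) (head [::] c.2.2) v) +
  \sum_(i <- iota 0 p.+1) @bgen X p (cface p.+1 i c) ((-1) ^+ i.+1 *: v).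
have lg : linear g.
  apply: linear_add_fun; first by move=> k u v; rewrite !linearP.
  by apply: linear_sum_fun => i k u v; rewrite scalerDr scalerA mulrC -scalerA linearP.
by move=> k u v; rewrite !sum_dterm; apply: lg.
Qed.

Lemma bar_diff_linear X p : linear (@bar_diff X p).
Proof. by apply: dlift_linear => c _; apply: bar_diff_gen_linear. Qed.
HB.instance Definition _ X p :=
  GRing.isLinear.Build K (bar X p.+1) (bar X p) _ (@bar_diff X p) (@bar_diff_linear X p).

Lemma bar_diff_gen X p c (v : X (chd c)) : valid p.+1 c ->
  bar_diff (bgen p.+1 v) = \sum_(t <- dterm p (@tmk K X c v)) bgen p (tagged t).
Proof.
by move=> vc; rewrite /bar_diff [LHS]dlift_gen // => *; apply: bar_diff_gen_linear.
Qed.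

Lemma coaug_hdiff X p (u : barD X p.+1 0) : coaug (hdiff u) = bar_diff (coaug u).
Proof.
move: u; apply: barD_ext => [||c a v ca].
- by apply: linear_comp_fun; [apply: coaug_linear|apply: hdiff_linear].
- by apply: linear_comp_fun; [apply: bar_diff_linear|apply: coaug_linear].
have /andP[/= vc _] := ca.
rewrite hdiff_gen // coaug_gen // bar_diff_gen // /hgen sum_dterm.
rewrite (linear_funD _ _ (@coaug_linear X p)) (linear_fun_sum _ _ (@coaug_linear X p)).
rewrite coaug_gen; last exact: barix_cface0 ca.
congr (_ + _); rewrite big_seq [RHS]big_seq; apply: eq_bigr => i.
by rewrite mem_iota add0n /= => ip; rewrite coaug_gen //; apply: barix_cface.
Qed.

Definition vdiff X p q : barD X p q.+1 -> barD X p q := @bd K (barS X p) q.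
HB.instance Definition _ X p q := GRing.isLinear.Build K (barD X p q.+1) (barD X p q) _
  (@vdiff X p q) (@bd_linear K (barS X p) q).

Definition bar_bicomplex X : bicomplex K.
Proof.
refine (@Bicomplex K (barD X) X (bar X) (fun p q => @hdiff X p q)
  (fun p q => @vdiff X p q) (fun q => @bd K X q) (fun p => @bar_diff X p)
  (fun q => @Daug X q) (fun p => @coaug X p) _ _ (@coaug_hdiff X) (@hdiff_hdiff X) _
  (@Daug_hdiff X) (@coaug_bd X) _ _ _ _ _ _).
- by move=> p q u; apply: (smap_bd (hmap X p)).
- by move=> q u; apply: (smap_bd (augmap X)).
- by move=> p q u; apply: (@bd_bd K (barS X p)).
- by move=> q x; exists (hsec x); apply: Daug_hsec.
- by move=> p s; exists (cosec s); apply: coaug_cosec.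
- move=> q u u0; exists (- hhtpy u).
  by rewrite linearN /= hdiff_hhtpy0 u0 (linear_fun0 (@hsec_linear X q)) sub0r opprK.
- move=> p u u0; exists (vhtpy u).
  by rewrite /= /vdiff bd_vhtpy0 u0 (linear_fun0 (@cosec_linear X p)) subr0.
- move=> p q u u0; exists ((-1) ^+ p *: hhtpy u).
  by rewrite linearZ /= hdiff_hhtpy u0 (linear_fun0 (@hhtpy_linear X p q)) add0r signrZK.
- move=> p q u u0; exists (vhtpy u).
  by rewrite /= /vdiff bd_vhtpy u0 (linear_fun0 (@vhtpy_linear X p q)) subr0.
Defined.

End BarModules.

(** * Functoriality of the bar double complex *)

Section BarFunctor.
Variables (K : fieldType) (X Y : sset K) (f : smap X Y).

Definition bar_map p : bar X p -> bar Y p := dlift (fun c v => bgen p (f (chd c) v)).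

Lemma bar_map_linear p : linear (@bar_map p).
Proof. by apply: dlift_linear => c _ k u v; rewrite !linearP. Qed.
HB.instance Definition _ p :=
  GRing.isLinear.Build K (bar X p) (bar Y p) _ (@bar_map p) (@bar_map_linear p).

Lemma bar_map_gen p c (v : X (chd c)) : valid p c ->
  bar_map (bgen p v) = bgen p (f (chd c) v).
Proof. by move=> vc; rewrite /bar_map [LHS]dlift_gen // => ? _ k u w; rewrite !linearP. Qed.

Definition barD_map p q : barD X p q -> barD Y p q :=
  Dlift (fun c a v => Dgen p q a (f (chd c) v)).

Lemma barD_map_linear p q : linear (@barD_map p q).
Proof. by apply: Dlift_linear => c a _ k u v; rewrite !linearP. Qed.
HB.instance Definition _ p q :=
  GRing.isLinear.Build K (barD X p q) (barD Y p q) _ (@barD_map p q) (@barD_map_linear p q).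

Lemma barD_map_gen p q c a (v : X (chd c)) : barix p q (c, a) ->
  barD_map (Dgen p q a v) = Dgen p q a (f (chd c) v).
Proof. by move=> ca; rewrite /barD_map Dlift_gen // => ? ? _ k u w; rewrite !linearP. Qed.

Fact barD_map_nat p m n b (u : barS X p n) : mono m n b ->
  barD_map (sact (barS X p) m n b u) = sact (barS Y p) m n b (barD_map u).
Proof.
move=> nb; move: u; apply: barD_ext => [||c a v ca].
- by apply: linear_comp_fun; [apply: barD_map_linear|apply: Dact_linear].
- by apply: linear_comp_fun; [apply: Dact_linear|apply: barD_map_linear].
rewrite /= Dact_gen // !barD_map_gen //; last exact: barix_dcomp nb.
by rewrite Dact_gen.
Qed.

Definition barS_map p : smap (barS X p) (barS Y p) :=
  @SMap K (barS X p) (barS Y p) (@barD_map p) (@barD_map_linear p) (@barD_map_nat p).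

Lemma valid_head p c : valid p.+1 c -> mono (chd (cface0 c)) (chd c) (head [::] c.2.2).
Proof. by case/and3P=> _ _ /andP[]; rewrite /= !nth0. Qed.

Lemma barD_map_hdiff p q (u : barD X p.+1 q) :
  barD_map (hdiff u) = hdiff (barD_map u).
Proof.
move: u; apply: barD_ext => [||c a v ca].
- by apply: linear_comp_fun; [apply: barD_map_linear|apply: hdiff_linear].
- by apply: linear_comp_fun; [apply: hdiff_linear|apply: barD_map_linear].
have /andP[/= vc _] := ca.
rewrite barD_map_gen // !hdiff_gen // /hgen.
rewrite (linear_funD _ _ (@barD_map_linear p q)).
rewrite (linear_fun_sum _ _ (@barD_map_linear p q)).
rewrite barD_map_gen; last exact: barix_cface0 ca.
rewrite smap_nat; last exact: valid_head vc.
congr (_ + _); rewrite big_seq [RHS]big_seq; apply: eq_bigr => i.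
rewrite mem_iota add0n /= => ip; rewrite barD_map_gen; last exact: barix_cface.
by rewrite (linear_funZ _ _ (@smap_lin K X Y f _)).
Qed.

Lemma bar_map_coaug p (u : barD X p 0) : bar_map (coaug u) = coaug (barD_map u).
Proof.
move: u; apply: barD_ext => [||c a v ca].
- by apply: linear_comp_fun; [apply: bar_map_linear|apply: coaug_linear].
- by apply: linear_comp_fun; [apply: coaug_linear|apply: barD_map_linear].
have /andP[/= vc _] := ca.
by rewrite coaug_gen // bar_map_gen // barD_map_gen // coaug_gen.
Qed.

(** Since [coaug] is onto and intertwines the differentials and the maps, the identity descends from
    [barD_map_hdiff]. *)
Lemma bar_map_diff p (s : bar X p.+1) : bar_map (bar_diff s) = bar_diff (bar_map s).
Proof.
rewrite -[s]coaug_cosec -coaug_hdiff bar_map_coaug barD_map_hdiff.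
by rewrite coaug_hdiff -bar_map_coaug.
Qed.

Lemma smap_Daug q (u : barD X 0 q) : f q (Daug u) = Daug (barD_map u).
Proof.
move: u; apply: barD_ext => [||c a v ca].
- by apply: linear_comp_fun; [apply: smap_lin|apply: Daug_linear].
- by apply: linear_comp_fun; [apply: Daug_linear|apply: barD_map_linear].
by rewrite Daug_gen // barD_map_gen // Daug_gen // smap_nat // barix0.
Qed.

Definition bar_bimorphism : bimorphism (bar_bicomplex X) (bar_bicomplex Y).
Proof.
refine (@Bimorphism K (bar_bicomplex X) (bar_bicomplex Y)
  (fun p q => @barD_map p q) (fun n => f n) (fun n => @bar_map n)
  barD_map_hdiff _ (smap_bd f) bar_map_diff smap_Daug bar_map_coaug).
by move=> p q u; apply: (smap_bd (barS_map p)).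
Defined.

Lemma quasi_iso_bar : quasi_iso f <->
  homology_iso (ndiff (@bar_diff K X)) (ndiff (@bar_diff K Y)) bar_map.
Proof. exact: (homology_iso_row_colE bar_bimorphism). Qed.

End BarFunctor.

(** * Tor as the homology of the bar complex *)

Section TorComparison.
Variables (K : fieldType).
Implicit Types X Y : sset K.

Definition tsum X p (s : seq (term X)) : bar X p :=
  \sum_(t <- s) @bgen K X p (tag t) (tagged t).

Lemma tvalidE X p (s : seq (term X)) : tvalid p s = all (valid p) (map tag s).
Proof. by rewrite all_map. Qed.

Lemma tsum_eqP X p (s1 s2 : seq (term X)) : tvalid p s1 -> tvalid p s2 ->
  tsum p s1 = tsum p s2 <-> forall c, coef s1 c = coef s2 c.
Proof. by rewrite !tvalidE => v1 v2; apply: (sum_gen_eqP v1 v2). Qed.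

Lemma tsum_onto X p (w : bar X p) : exists2 s, tvalid p s & w = tsum p s.
Proof. by have [s vs ->] := dsum_gen w; exists s; rewrite ?tvalidE. Qed.

Lemma tvalid_dterm X p (t : term X) : valid p.+1 (tag t) -> tvalid p (dterm p t).
Proof.
case: t => c v vc; rewrite /tvalid /dterm -cat1s all_cat all_seq1 all_map.
apply/andP; split; first exact: valid_cface0.
apply/allP => i; rewrite mem_iota add0n => ip; exact: valid_cface.
Qed.

Lemma tvalid_bar_d X p (s : seq (term X)) : tvalid p.+1 s -> tvalid p (bar_d p s).
Proof.
rewrite /tvalid /bar_d => /allP vs; apply/allP => t /flatten_mapP[t' /vs vt'].
by move/(allP (tvalid_dterm vt')).
Qed.

Lemma tsum_bar_d X p (s : seq (term X)) : tvalid p.+1 s ->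
  tsum p (bar_d p s) = bar_diff (tsum p.+1 s).
Proof.
move=> /allP vs; rewrite /tsum big_flatten big_map linear_sum big_seq [RHS]big_seq.
by apply: eq_bigr => -[c v] /vs /= vc; rewrite bar_diff_gen.
Qed.

Lemma tvalid_tmap X Y (f : smap X Y) p s : tvalid p (tmap f s) = tvalid p s.
Proof. by rewrite /tvalid all_map. Qed.

Lemma tsum_tmap X Y (f : smap X Y) p s : tvalid p s ->
  tsum p (tmap f s) = bar_map f (tsum p s).
Proof.
move=> /allP vs; rewrite /tsum big_map linear_sum big_seq [RHS]big_seq.
by apply: eq_bigr => -[c v] /vs /= vc; rewrite bar_map_gen.
Qed.

Lemma coef_nil X c : coef (X := X) [::] c = 0.
Proof. by rewrite /coef big_nil. Qed.

Lemma coef_cat X (s1 s2 : seq (term X)) c : coef (s1 ++ s2) c = coef s1 c + coef s2 c.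
Proof. by rewrite /coef big_cat. Qed.

Lemma bar_cycleP X p (s : seq (term X)) :
  bar_cycle p s <-> tvalid p s /\ ndiff (@bar_diff K X) (tsum p s) = 0.
Proof.
rewrite /bar_cycle; case: p => [|p] /=; first by split=> -[].
have t0 : tsum p ([::] : seq (term X)) = 0 by rewrite /tsum big_nil.
split=> -[vs ds]; split=> //.
  rewrite -tsum_bar_d // -t0; apply/tsum_eqP => //; first exact: tvalid_bar_d.
  by move=> c; rewrite coef_nil.
suff e c : coef (bar_d p s) c = coef [::] c by move=> c; rewrite e coef_nil.
move: c; apply/(tsum_eqP (p := p)) => //.
  exact: tvalid_bar_d.
by rewrite tsum_bar_d // ds.
Qed.

Lemma bar_homologousP X p (s1 s2 : seq (term X)) : tvalid p s1 -> tvalid p s2 ->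
  bar_homologous p s1 s2 <-> exists w, tsum p s1 = tsum p s2 + bar_diff w.
Proof.
move=> v1 v2; have key s' : tvalid p.+1 s' ->
    (forall c, coef s1 c = coef s2 c + coef (bar_d p s') c) <->
    tsum p s1 = tsum p s2 + bar_diff (tsum p.+1 s').
  move=> v'; rewrite -tsum_bar_d // -[X in _ = X]big_cat -/(tsum p (s2 ++ bar_d p s')).
  rewrite tsum_eqP //; last by rewrite /tvalid all_cat [all _ _]v2 [all _ _]tvalid_bar_d.
  by split=> e c; rewrite e coef_cat.
split=> [[s' [v' /(key _ v') e]]|[w]]; first by exists (tsum p.+1 s').
by have [s' v' ->] := tsum_onto w => /(key _ v') e; exists s'.
Qed.

Lemma tor_iso_bar X Y (f : smap X Y) : (forall p, tor_iso f p) <->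
  homology_iso (ndiff (@bar_diff K X)) (ndiff (@bar_diff K Y)) (bar_map f).
Proof.
have t0 Z p : tsum p ([::] : seq (term Z)) = 0 by rewrite /tsum big_nil.
split=> tf p; have [inj surj] := tf p; split.
- move=> x; have [s vs ->] := tsum_onto x => ds [y' ey'].
  have : bar_homologous p s [::].
    apply: inj; first exact/bar_cycleP.
    apply/bar_homologousP; rewrite ?tvalid_tmap //.
    by exists y'; rewrite tsum_tmap // t0 add0r -ey'.
  by case/bar_homologousP => // w; rewrite t0 add0r => ->; exists w.
- move=> z; have [s vs ->] := tsum_onto z => ds.
  have [|s' [/bar_cycleP[vs' ds']]] := surj s; first exact/bar_cycleP.
  case/bar_homologousP; rewrite ?tvalid_tmap // => w; rewrite tsum_tmap // => e.
  by exists (tsum p s'); split=> //; exists w.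
- move=> s /bar_cycleP[vs ds] /bar_homologousP; rewrite tvalid_tmap => /(_ vs isT)[w].
  rewrite tsum_tmap // t0 add0r => e.
  have [|y ey] := inj _ ds; first by exists w.
  by apply/bar_homologousP => //; exists y; rewrite t0 add0r -ey.
move=> z /bar_cycleP[vz dz]; have [x] := surj _ dz.
have [s vs ->] := tsum_onto x => -[ds [y' ey']].
exists s; split; first exact/bar_cycleP.
by apply/bar_homologousP; rewrite ?tvalid_tmap //; exists y'; rewrite tsum_tmap.
Qed.

End TorComparison.

(** * Duality and Ext *)

Section Functionals.
Variables (K : fieldType) (V : lmodType K).
Implicit Types (R S : set (V * K)).

Let good R := [/\ R (0, 0),
  forall c u v a b, R (u, a) -> R (v, b) -> R (c *: u + v, c * a + b) &
  forall k, R (0, k) -> k = 0].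

(** [R] is the graph of a partial functional: a subspace of V x K, single-valued by the last
    hypothesis. A relation lets values be prescribed on images without choosing preimages. *)
Lemma scalar_extension R : R (0, 0) ->
    (forall c u v a b, R (u, a) -> R (v, b) -> R (c *: u + v, c * a + b)) ->
    (forall k, R (0, k) -> k = 0) ->
  exists2 F : V -> K, scalar F & forall v k, R (v, k) -> F v = k.
Proof.
move=> R0 RD Rs.
(* Adjoining [R] makes the condition hold for the union of the empty chain as well. *)
have [|A [[A0 AD As] Amax]] := @Zorn_bigcup (V * K)%type (fun S => good (R `|` S)).
  move=> F Fgood Ftot; split=> [|c u v a b|k]; first by left.
  - move=> [Ru|[S FS Su]] [Rv|[S' FS' Sv]]; first by left; apply: RD.
    + have [_ SD _] := Fgood S' FS'.
      by case: (SD c u v a b (or_introl Ru) (or_intror Sv)); [left|right; exists S'].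
    + have [_ SD _] := Fgood S FS.
      by case: (SD c u v a b (or_intror Su) (or_introl Rv)); [left|right; exists S].
    have [SS'|S'S] := Ftot S S' FS FS'.
      have [_ SD _] := Fgood S' FS'.
      by case: (SD c u v a b (or_intror (SS' _ Su)) (or_intror Sv)); [left|right; exists S'].
    have [_ SD _] := Fgood S FS.
    by case: (SD c u v a b (or_intror Su) (or_intror (S'S _ Sv))); [left|right; exists S].
  by case=> [|[S FS Sk]]; [exact: Rs|have [_ _ Ss] := Fgood S FS; apply: Ss; right].
pose T := (R `|` A)%classic.
have Tdom v0 : exists k, T (v0, k).
  apply: contrapT => nT.
  (* Extend the functional by the value 0 at [v0]. It stays single-valued, since [u + c *: v0 = 0]
     with [c] nonzero would put [v0] in the domain. *)
  pose B : set (V * K) := fun w => exists2 u, T u & exists c, w = (u.1 + c *: v0, u.2).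
  have TB u : T u -> B u.
    by move=> Tu; exists u => //; exists 0; rewrite scale0r addr0; case: u Tu.
  have RB : (R `|` B)%classic = B by apply: setUidr => u Ru; apply: TB; left.
  apply: (Amax B).
    split=> [u Au|BA]; first by apply: TB; right.
    apply: nT; exists 0; right; apply: BA; exists (0, 0) => //.
    by exists 1; rewrite scale1r add0r.
  rewrite RB; split; first exact: TB.
    move=> c u v a b [[u' a'] Tu [e [-> ->]]] [[v' b'] Tv [e' [-> ->]]] /=.
    exists (c *: u' + v', c * a' + b'); first exact: AD.
    exists (c * e + e'); congr (_, _); rewrite /= scalerDr scalerDl scalerA.
    by rewrite addrACA.
  move=> k [[u a] Tu [c [/= e ->]]].
  have [c0|c0] := eqVneq c 0.
    by apply: As; move: e; rewrite c0 scale0r addr0 => ->.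
  case: nT; exists (- c^-1 * a).
  have := AD (- c^-1) _ 0 _ 0 Tu A0; rewrite !addr0.
  suff -> : - c^-1 *: u = v0 by [].
  have -> : u = - (c *: v0) by apply/eqP; rewrite -addr_eq0 -e.
  by rewrite scaleNr scalerN opprK scalerA mulVf // scale1r.
have Tfun v a b : T (v, a) -> T (v, b) -> a = b.
  move=> Ta Tb; have := AD (-1) _ _ _ _ Ta Tb.
  by rewrite scaleN1r addNr mulN1r => /As/eqP; rewrite addrC subr_eq0 => /eqP.
have [F FT] := choice Tdom; exists F.
  by move=> c u v; apply: (Tfun (c *: u + v)); [exact: FT|apply: AD; exact: FT].
by move=> v k Rvk; apply: (Tfun v); [exact: FT|left].
Qed.

(** Prescribe the value [k] at [s + k *: x]; this is consistent, since [s + k *: x = 0] with [k]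
    nonzero would put [x] in [S]. *)
Lemma scalar_separation (S : V -> Prop) (x : V) : S 0 ->
    (forall c u v, S u -> S v -> S (c *: u + v)) -> ~ S x ->
  exists F : V -> K, [/\ scalar F, forall v, S v -> F v = 0 & F x = 1].
Proof.
move=> S0 SD nSx.
have [||| F lF FS] := @scalar_extension
    (fun w => exists2 s, S s & w.1 = s + w.2 *: x).
- by exists 0; rewrite ?scale0r ?addr0.
- move=> c u v a b [s Ss /= ->] [t St /= ->]; exists (c *: s + t); first exact: SD.
  by rewrite /= scalerDr scalerDl scalerA addrACA.
- move=> k [s Ss /= /eqP]; rewrite eq_sym addr_eq0 => /eqP es.
  apply: contrapT => /eqP k0; apply: nSx.
  have -> : x = - k^-1 *: s + 0.
    by rewrite es scaleNr scalerN opprK scalerA mulVf // scale1r addr0.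
  exact: SD.
exists F; split=> // [v Sv|]; first by apply: FS; exists v; rewrite //= scale0r addr0.
by apply: FS; exists 0; rewrite //= scale1r add0r.
Qed.

End Functionals.

(** * A map of complexes and its dual *)

Section Duality.
Variables (K : fieldType).

Definition cocycle (A : nat -> lmodType K) (d : forall n, A n.+1 -> A n) n
    (phi : A n -> K) : Prop :=
  scalar phi /\ forall y, phi (d n y) = 0.

(** In degree 0 [ndiff d] is zero, so the condition says that [phi] vanishes. *)
Definition coboundary (A : nat -> lmodType K) (d : forall n, A n.+1 -> A n) n
    (phi : A n -> K) : Prop :=
  exists2 psi : A n.-1 -> K, scalar psi & forall x, phi x = psi (ndiff d x).

Definition cohomology_iso (A B : nat -> lmodType K)
    (dA : forall n, A n.+1 -> A n) (dB : forall n, B n.+1 -> B n)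
    (g : forall n, A n -> B n) : Prop :=
  forall n,
  (forall phi : B n -> K, cocycle dB phi -> coboundary dA (fun x => phi (g n x)) ->
    coboundary dB phi) /\
  (forall theta : A n -> K, cocycle dA theta -> exists phi : B n -> K,
    cocycle dB phi /\ coboundary dA (fun x => theta x - phi (g n x))).

Lemma scalar0 (V : lmodType K) (phi : V -> K) : scalar phi -> phi 0 = 0.
Proof. exact: (@linear_fun0 K V K^o). Qed.

Lemma scalarB (V : lmodType K) (phi : V -> K) u v :
  scalar phi -> phi (u - v) = phi u - phi v.
Proof. by move=> lp; rewrite addrC -scaleN1r lp mulN1r addrC. Qed.

Lemma ndiff_linear (A : nat -> lmodType K) (d : forall n, {linear A n.+1 -> A n}) n :
  linear (@ndiff K A d n).
Proof.
by case: n => [|n] c u v /=; rewrite ?linearP // scaler0 addr0.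
Qed.

(** Vanishing on cycles makes [ndiff d x |-> phi x] well defined on the image of the differential,
    and over a field it extends to the whole space. *)
Lemma coboundary_of_cycle (A : nat -> lmodType K) (d : forall n, {linear A n.+1 -> A n})
    n (phi : A n -> K) :
  scalar phi -> (forall x, ndiff d x = 0 -> phi x = 0) -> coboundary d phi.
Proof.
move=> lp p0; have ld := @ndiff_linear A d n.
have [|||F lF FR] := @scalar_extension K (A n.-1)
    (fun w => exists2 x, w.1 = ndiff d x & w.2 = phi x).
- by exists 0; rewrite /= ?(linear_fun0 ld) ?scalar0.
- by move=> c u v a b [x /= -> ->] [y /= -> ->]; exists (c *: x + y); rewrite ?ld ?lp.
- by move=> k [x /= /esym/p0 e ->].
by exists F => // x; rewrite (FR (ndiff d x) (phi x)) //; exists x.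
Qed.

Variables (A B : nat -> lmodType K).
Variables (dA : forall n, {linear A n.+1 -> A n}) (dB : forall n, {linear B n.+1 -> B n}).
Variable g : forall n, {linear A n -> B n}.

Lemma homology_cohomology_iso :
  homology_iso (ndiff dA) (ndiff dB) g <-> cohomology_iso dA dB g.
Proof.
have lA n := @ndiff_linear A dA n; have lB n := @ndiff_linear B dB n.
split=> gi n; have [inj surj] := gi n; split.
- move=> phi [lp pd] [psi lpsi e]; apply: coboundary_of_cycle => // z dz.
  have [x [dx [y' ey']]] := surj z dz.
  have -> : z = g n x - dB n y' by rewrite ey' addrK.
  by rewrite scalarB // e pd dx scalar0 // subr0.
- move=> theta [lt td].
  (* Transport [theta] to the images of cycles and set it to 0 on boundaries; consistency is exactly
     injectivity on homology. *)
  have [|||F lF FR] := @scalar_extension K (B n)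
      (fun w => exists x y', [/\ ndiff dA x = 0, w.1 = g n x + dB n y' & w.2 = theta x]).
  + by exists 0, 0; split; rewrite ?(linear_fun0 (lA n)) ?linear0 ?addr0 ?scalar0.
  + move=> c u v a b [x [y [dx /= -> ->]]] [x' [y' [dx' /= -> ->]]].
    exists (c *: x + x'), (c *: y + y'); split; rewrite ?lt //=.
      by rewrite lA dx dx' scaler0 addr0.
    by rewrite !linearP scalerDr addrACA.
  + move=> k [x [y' [dx /= /esym/eqP]]]; rewrite addr_eq0 => /eqP e ->.
    have [|y <-] := inj x dx; first by exists (- y'); rewrite /= linearN e.
    exact: td.
  exists F; split.
    split=> // y; apply: FR; exists 0, y.
    by split; rewrite ?(linear_fun0 (lA n)) ?linear0 ?add0r ?scalar0.
  apply: coboundary_of_cycle => [c u v|x dx].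
    by rewrite lt linearP lF opprD mulrBr addrACA.
  apply/eqP; rewrite subr_eq0 eq_sym; apply/eqP; apply: FR; exists x, 0.
  by rewrite linear0 addr0.
- move=> x dx [y' ey']; apply: contrapT => nx.
  have [|||F [lF F0 Fx]] := @scalar_separation K (A n) (fun x => exists y, x = dA n y) x.
  + by exists 0; rewrite linear0.
  + by move=> c _ _ [y ->] [z ->]; exists (c *: y + z); rewrite linearP.
  + by case=> y e; apply: nx; exists y.
  (* On the cycle [x] the coboundary vanishes, and [phi] vanishes on the boundary [g n x]; so
     [F x = 0], against [F x = 1]. *)
  have [phi [[lp pd] [psi lpsi /(_ x)]]] : exists phi, cocycle dB phi /\
      coboundary dA (fun x => F x - phi (g n x)).
    by apply: surj; split=> // y; apply: F0; exists y.
  rewrite dx scalar0 // Fx -ey' /= pd subr0 => /eqP.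
  by rewrite oner_eq0.
move=> z dz; apply: contrapT => nz.
(* The cycles among these are those whose classes come from A. A functional that kills [S] is a
   cocycle with trivial pullback, hence a coboundary, and cannot take the value 1 on the cycle
   [z]. *)
pose S z := exists x y', ndiff dA x = 0 /\ z = g n x + dB n y'.
have [|||F [lF F0 Fz]] := @scalar_separation K (B n) S z.
- by exists 0, 0; rewrite (linear_fun0 (lA n)) !linear0 addr0.
- move=> c _ _ [x [y [dx ->]]] [x' [y' [dx' ->]]].
  exists (c *: x + x'), (c *: y + y'); rewrite lA dx dx' scaler0 addr0.
  by rewrite !linearP scalerDr addrACA.
- case=> x [y [dx e]]; apply: nz; exists x; split=> //; exists (- y).
  by rewrite e /= linearN addrK.
have [psi lpsi e] : coboundary dB F.
  apply: inj.
    split=> // y; apply: F0; exists 0, y.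
    by rewrite (linear_fun0 (lA n)) linear0 add0r.
  apply: coboundary_of_cycle => [c u v|x dx]; first by rewrite linearP lF.
  by apply: F0; exists x, 0; rewrite linear0 addr0.
by move: (e z); rewrite dz scalar0 // Fz => /eqP; rewrite oner_eq0.
Qed.

End Duality.

(** * Ext as the cohomology of the dual bar complex *)

Section ExtComparison.
Variables (K : fieldType).
Implicit Types X Y : sset K.

(** Cochains of degree [p] correspond to functionals on [bar X p]; the inverse [funco] recovers a
    cochain on valid chains. *)
Definition cofun X p (phi : cochain X) : bar X p -> K := dlift (V := K^o) phi.

Definition funco X p (F : bar X p -> K) : cochain X := fun c v => F (bgen p v).

Lemma cofun_scalar X p (phi : cochain X) : is_cochain p phi -> scalar (@cofun X p phi).
Proof. by move=> cp; apply: (dlift_linear (V := K^o)). Qed.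

Lemma cofun_gen X p (phi : cochain X) c (v : X (chd c)) :
  is_cochain p phi -> valid p c -> cofun phi (bgen p v) = phi c v.
Proof. by move=> cp vc; apply: (dlift_gen (V := K^o)). Qed.

Lemma bar_scalar_ext X p (F G : bar X p -> K) : scalar F -> scalar G ->
    (forall c (v : X (chd c)), valid p c -> F (bgen p v) = G (bgen p v)) ->
  forall w, F w = G w.
Proof. by move=> lF lG; apply: (dsum_ext (V := K^o)). Qed.

Lemma funco_cochain X p (F : bar X p -> K) : scalar F -> is_cochain p (funco F).
Proof. by move=> lF c vc a u v; rewrite /funco linearP lF. Qed.

Lemma funcoK X p (F : bar X p -> K) : scalar F -> forall w, cofun (funco F) w = F w.
Proof.
move=> lF; have cF := funco_cochain lF; apply: bar_scalar_ext => //.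
  exact: cofun_scalar.
by move=> c v vc; rewrite cofun_gen.
Qed.

Lemma cod_cofun X p (phi : cochain X) c (v : X (chd c)) : is_cochain p phi ->
  valid p.+1 c -> cod p phi v = cofun phi (bar_diff (bgen p.+1 v)).
Proof.
move=> cp vc; rewrite bar_diff_gen // /cod /ceval.
rewrite [RHS](@linear_fun_sum K _ K^o _ _ _ _ (cofun_scalar cp)) big_seq [RHS]big_seq.
apply: eq_bigr => t tin; rewrite cofun_gen //.
exact: (allP (@tvalid_dterm K X p (tmk v) vc)).
Qed.

Lemma ext_cocycleP X p (phi : cochain X) : is_cochain p phi ->
  ext_cocycle p phi <-> cocycle (@bar_diff K X) (@cofun X p phi).
Proof.
move=> cp; have lp := cofun_scalar cp; split=> [[_ dp]|[_ dp]]; split=> //.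
  apply: (bar_scalar_ext (F := fun y => cofun phi (bar_diff y)) (G := fun=> 0)).
  - by move=> c u v; rewrite linearP lp.
  - by move=> c u v; rewrite mulr0 addr0.
  by move=> c v vc; rewrite -cod_cofun // dp.
by move=> c vc v; rewrite cod_cofun.
Qed.

Lemma ext_cohomologousP X p (phi1 phi2 : cochain X) :
    is_cochain p phi1 -> is_cochain p phi2 ->
  ext_cohomologous p phi1 phi2 <->
  coboundary (@bar_diff K X) (fun w : bar X p => cofun phi1 w - cofun phi2 w).
Proof.
move=> c1 c2; have l1 := cofun_scalar c1; have l2 := cofun_scalar c2.
have l12 : scalar (fun w : bar X p => cofun phi1 w - cofun phi2 w).
  by move=> c u v; rewrite /= l1 l2 opprD mulrBr addrACA.
case: p c1 c2 l1 l2 l12 => [|p] c1 c2 l1 l2 l12 /=; split.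
- move=> e; exists (fun=> 0) => [c u v|]; first by rewrite mulr0 addr0.
  move=> w; apply/eqP; rewrite subr_eq0; apply/eqP; move: w.
  by apply: bar_scalar_ext => // c v vc; rewrite !cofun_gen // e.
- move=> [psi lpsi e] c vc v; have /eqP := e (bgen 0 v).
  by rewrite !cofun_gen //= scalar0 // subr_eq0 => /eqP.
- move=> [psi [cpsi e]]; exists (cofun psi); first exact: cofun_scalar.
  apply: (bar_scalar_ext (G := fun x => cofun psi (bar_diff x))) => //.
    by move=> c u v; rewrite linearP (cofun_scalar cpsi).
  by move=> c v vc; rewrite !cofun_gen // e // addrC addKr cod_cofun.
move=> [psi lpsi e]; exists (funco psi); split; first exact: funco_cochain.
move=> c vc v; rewrite cod_cofun //; last exact: funco_cochain.
by rewrite funcoK // -(e (bgen p.+1 v)) !cofun_gen // addrC subrK.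
Qed.

Lemma cpull_cochain X Y (f : smap X Y) p (phi : cochain Y) :
  is_cochain p phi -> is_cochain p (cpull f phi).
Proof. by move=> cp c vc a u v; rewrite /cpull linearP cp. Qed.

Lemma cofun_cpull X Y (f : smap X Y) p (phi : cochain Y) : is_cochain p phi ->
  forall w : bar X p, cofun (cpull f phi) w = cofun phi (bar_map f w).
Proof.
move=> cp; apply: (bar_scalar_ext (G := fun w => cofun phi (bar_map f w))).
- exact/cofun_scalar/cpull_cochain.
- by move=> c u v; rewrite linearP (cofun_scalar cp).
by move=> c v vc; rewrite bar_map_gen // !cofun_gen //; apply: cpull_cochain.
Qed.

Lemma ext_iso_bar X Y (f : smap X Y) : (forall p, ext_iso f p) <->
  cohomology_iso (@bar_diff K X) (@bar_diff K Y) (bar_map f).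
Proof.
have c0 Z p : is_cochain p (@czero K Z) by move=> c _ a u v; rewrite mulr0 addr0.
have cof0 Z p (w : bar Z p) : cofun (@czero K Z) w = 0.
  move: w; apply: (bar_scalar_ext (G := fun=> 0)); first exact: cofun_scalar.
    by move=> c u v; rewrite mulr0 addr0.
  by move=> c v vc; rewrite cofun_gen.
have cobE (A : nat -> lmodType K) d n (phi psi : A n -> K) : phi =1 psi ->
    coboundary d phi -> coboundary d psi.
  by move=> e [xi lxi exi]; exists xi => // x; rewrite -e.
split=> ef p; have [inj surj] := ef p; split.
- move=> F [lF dF] cF; have cp := funco_cochain lF; have FK := funcoK lF.
  have : ext_cohomologous p (funco F) (@czero K Y).
    apply: inj; first by apply/ext_cocycleP => //; split=> [|y]; [exact: cofun_scalar|rewrite FK].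
    apply/ext_cohomologousP => //; first exact: cpull_cochain.
    by apply: cobE cF => w; rewrite cofun_cpull // FK cof0 subr0.
  by move/ext_cohomologousP => /(_ cp (c0 _ _)); apply: cobE => w; rewrite FK cof0 subr0.
- move=> F [lF dF]; have cp := funco_cochain lF; have FK := funcoK lF.
  have [|phi [phic]] := surj (funco F).
    by apply/ext_cocycleP => //; split=> [|y]; [exact: cofun_scalar|rewrite FK].
  have cphi := phic.1; move/ext_cohomologousP => /(_ cp (cpull_cochain f cphi)) cob.
  exists (cofun phi); split; first exact/ext_cocycleP.
  by apply: cobE cob => w; rewrite FK cofun_cpull.
- move=> phi phic; have cphi := phic.1; have cpf := cpull_cochain f cphi.
  move/ext_cohomologousP => /(_ cpf (c0 _ _)) cob; apply/ext_cohomologousP => //.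
  have := inj (cofun phi); move/(_ (proj1 (ext_cocycleP cphi) phic)).
  have /[swap] /[apply] : coboundary (@bar_diff K X) (fun x => cofun phi (bar_map f (x : bar X p))).
    by apply: cobE cob => w; rewrite cofun_cpull // cof0 subr0.
  by apply: cobE => w; rewrite cof0 subr0.
move=> theta thetac; have ct := thetac.1.
have [F [[lF dF] cob]] := surj (cofun theta) (proj1 (ext_cocycleP ct) thetac).
have cF := funco_cochain lF; have FK := funcoK lF.
exists (funco F); split.
  by apply/ext_cocycleP => //; split=> [|y]; [exact: cofun_scalar|rewrite FK].
apply/ext_cohomologousP => //; first exact: cpull_cochain.
by apply: cobE cob => w; rewrite cofun_cpull // FK.
Qed.

End ExtComparison.

Theorem theorem3p2 (K : fieldType) (X Y : sset K) (f : smap X Y) :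
  ((forall n, pi_iso f n) <-> quasi_iso f) /\
  ((forall n, pi_iso f n) <-> (forall n, tor_iso f n)) /\
  ((forall n, pi_iso f n) <-> (forall n, ext_iso f n)).
Proof.
have bar_iso := quasi_iso_bar f.
have dual : homology_iso (ndiff (@bar_diff K X)) (ndiff (@bar_diff K Y)) (bar_map f) <->
    cohomology_iso (@bar_diff K X) (@bar_diff K Y) (bar_map f).
  exact: (@homology_cohomology_iso K (bar X) (bar Y) (fun n => @bar_diff K X n)
    (fun n => @bar_diff K Y n) (fun n => @bar_map K X Y f n)).
rewrite pi_iso_quasi_iso tor_iso_bar ext_iso_bar bar_iso.
by split; [|split].
Qed.
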